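(* Let $\mathcal C=(\rho_i)_{i\in A}$ be a continuous family in $\mathcal T$ such that $m(\mathcal C)<m_\infty(\mathcal C)$. Then there is an equivalent family $\mathcal B=(\zeta_j)_{j\in B}$ satisfying the following properties: (1) $\mathcal B$ is well-ordered and all valuations $\zeta_j\in\mathcal B$ have degree $m(\mathcal C)$. (2) All valuations $\zeta_j\in\mathcal B$ have relative ramification index equal to one. (3) All valuations $\zeta_j\in\mathcal B$ have value group $\Gamma_{\zeta_j}=\Gamma_{\mathcal B}$, the stable group of $\mathcal B$. (4) For all $j\in B$ there exist $\chi_j\in\mathrm{KP}(\zeta_j)$ of minimal degree such that, for all $j<k$ in $B$, $$\chi_j\not\sim_{\zeta_j}\chi_k\quad\text{and}\quad \zeta_k=[\zeta_j;\,\chi_k,\mathrm{sv}(\zeta_k)].$$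
   Context: $(K,v)$ is a valued field, $\Gamma=v(K^* )$, and $\Gamma\hookrightarrow\Lambda$ is a fixed extension of ordered abelian groups; $\Lambda\infty=\Lambda\cup\{\infty\}$. $\mathcal T$ is the set of all valuations $\mu\colon K[x]\to\Lambda\infty$ (that is, $\mu(1)=0$, $\mu(0)=\infty$, $\mu(ab)=\mu(a)+\mu(b)$, $\mu(a+b)\ge\min\{\mu(a),\mu(b)\}$; nontrivial support $\mu^{-1}(\infty)$ is allowed) whose restriction to $K$ is $v$, ordered by $\mu\le\nu\iff\mu(f)\le\nu(f)$ for all $f$. $\Gamma_\mu$ denotes the value group of $\mu$. Maximal elements of $\mathcal T$ are leaves, the others are inner nodes. Key polynomials. For $\mu\in\mathcal T$ and $\alpha\in\Gamma_\mu$ let $\mathcal P_\alpha=\{g\mid\mu(g)\ge\alpha\}$, $\mathcal P_\alpha^+=\{g\mid\mu(g)>\alpha\}$, $\mathcal G_\mu=\bigoplus_{\alpha\in\Gamma_\mu}\mathcal P_\alpha/\mathcal P_\alpha^+$; $\mathrm{in}_\mu g=g+\mathcal P^+_{\mu(g)}$ if $\mu(g)<\infty$ and $\mathrm{in}_\mu g=0$ otherwise. Write $g\sim_\mu h$ if $\mathrm{in}_\mu g=\mathrm{in}_\mu h$, and $h\mid_\mu g$ if $\mathrm{in}_\mu h$ divides $\mathrm{in}_\mu g$ in $\mathcal G_\mu$. $g$ is $\mu$-irreducible if $(\mathrm{in}_\mu g)\mathcal G_\mu$ is a nonzero prime ideal, and $\mu$-minimal if $g\nmid_\mu f$ for all nonzero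 $f$ with $\deg f<\deg g$. $\mathrm{KP}(\mu)$ is the set of monic polynomials that are both $\mu$-minimal and $\mu$-irreducible (key polynomials); $\mu$ is inner iff $\mathrm{KP}(\mu)\ne\emptyset$. For inner $\mu$, $\deg(\mu)=\deg(\phi)$ and $\mathrm{sv}(\mu)=\mu(\phi)$ for any $\phi\in\mathrm{KP}(\mu)$ of minimal degree. For $\phi\in\mathrm{KP}(\mu)$ and $\gamma\in\Lambda\infty$ with $\gamma>\mu(\phi)$, the augmented valuation $\nu=[\mu;\phi,\gamma]\in\mathcal T$ is defined on $\phi$-expansions $f=\sum_s a_s\phi^s$, $\deg(a_s)<\deg(\phi)$, by $\nu(f)=\min_s\{\mu(a_s)+s\gamma\}$. For an inner node $\rho$ let $\Gamma_\rho^0=\{\rho(a)\mid a\in K[x],\ 0\le\deg(a)<\deg(\rho)\}$, a subgroup of $\Gamma_\rho$; the relative ramification index of $\rho$ is the index $(\Gamma_\rho:\Gamma_\rho^0)$. Continuous families. A continuous family is a family $\mathcal C=(\rho_i)_{i\in A}$ of inner nodes of $\mathcal T$, indexed by a totally ordered set $A$ with $i\mapsto\rho_i$ an isomorphism of ordered sets onto $\{\rho_i\}$, containing no maximal element, and such that $\deg(\rho_i)$ is constant for $i$ large enough; this constant is the stable degree $m(\mathcal C)$. A polynomial $f\in K[x]$ is $\mathcal C$-stable if there is $i\in A$ with $\rho_i(f)=\rho_j(f)$ for all $j>i$ in $A$ (so $0$ counts as stable); its stable value is $\rho_{\mathcal C}(f)=\max_i\rho_i(f)$. Otherwise $f$ is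 $\mathcal C$-unstable. The unstable degree $m_\infty(\mathcal C)$ is the minimal degree of a monic $\mathcal C$-unstable polynomial, and $m_\infty(\mathcal C)=\infty$ if all polynomials are $\mathcal C$-stable. The stable group $\Gamma_{\mathcal C}\subset\Lambda$ is the set of stable values of nonzero $\mathcal C$-stable polynomials. Two totally ordered families of inner nodes without maximal element are equivalent if they are cofinal in each other. *)

(* Defs.v *)
From HB Require Import structures.
From mathcomp Require Import all_boot all_order all_algebra.
From mathcomp Require Import generic_quotient ring_quotient.
From mathcomp Require Import boolp classical_sets functions cardinality.

Set Implicit Arguments.
Unset Strict Implicit.
Unset Printing Implicit Defensive.

Import Order.TTheory GRing.Theory.

Local Open Scope classical_set_scope.
Local Open Scope quotient_scope.
Local Open Scope card_scope.
Local Open Scope ring_scope.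

(* Totality is a field of the mixin because the library has no join of
   [Order.Total] and [GRing.Zmodule] below [realDomainType]. *)
HB.mixin Record POrderedZmodule_isOrderedAbelianGroup T
    of Num.POrderedZmodule T := {
  oag_le_total : total (<=%R : rel T);
  oag_leD2l : forall x y z : T, x <= y -> z + x <= z + y
}.

#[short(type="ordAbGroupType")]
HB.structure Definition OrderedAbelianGroup :=
  { T of Num.POrderedZmodule T & POrderedZmodule_isOrderedAbelianGroup T }.

(* [wtop T] is T with a largest element [Infty] adjoined. *)

Variant wtop (T : Type) := Fin of T | Infty.
Arguments Infty {T}.

Section WithTop.
Variable T : Type.

Definition opt_of_wtop (x : wtop T) := if x is Fin a then Some a else None.
Definition wtop_of_opt x := if x is Some a then Fin a else @Infty T.
Lemma opt_of_wtopK : cancel opt_of_wtop wtop_of_opt.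
Proof. by case. Qed.

Definition wtop_map (U : Type) (f : T -> U) (x : wtop T) : wtop U :=
  if x is Fin a then Fin (f a) else Infty.

End WithTop.

HB.instance Definition _ (T : eqType) :=
  Equality.copy (wtop T) (can_type (@opt_of_wtopK T)).
HB.instance Definition _ (T : choiceType) :=
  Choice.copy (wtop T) (can_type (@opt_of_wtopK T)).

Section WithTopOrder.
Variables (d : Order.disp_t) (T : porderType d).
Implicit Types x y z : wtop T.

Definition wtop_le x y : bool :=
  match x, y with
  | _, Infty => true
  | Fin a, Fin b => (a <= b)%O
  | Infty, Fin _ => false
  end.

Lemma wtop_le_refl : reflexive wtop_le.
Proof. by case=> [a|] //=. Qed.
Lemma wtop_le_anti : antisymmetric wtop_le.
Proof. by move=> [a|] [b|] //= /le_anti ->. Qed.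
Lemma wtop_le_trans : transitive wtop_le.
Proof. by move=> [b|] [a|] [c|] //=; apply: le_trans. Qed.

HB.instance Definition _ := Order.Le_isPOrder.Build d (wtop T)
  wtop_le_refl wtop_le_anti wtop_le_trans.

End WithTopOrder.

Section WithTopAdd.
Variable L : zmodType.
Implicit Types x y z : wtop L.

Definition wtop_add x y : wtop L :=
  match x, y with Fin a, Fin b => Fin (a + b) | _, _ => Infty end.
Lemma wtop_addA : associative wtop_add.
Proof. by move=> [a|] [b|] [c|] //=; rewrite addrA. Qed.
Lemma wtop_addC : commutative wtop_add.
Proof. by move=> [a|] [b|] //=; rewrite addrC. Qed.
Lemma wtop_add0 : left_id (Fin 0) wtop_add.
Proof. by move=> [a|] //=; rewrite add0r. Qed.

HB.instance Definition _ :=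
  GRing.isNmodule.Build (wtop L) wtop_addA wtop_addC wtop_add0.

End WithTopAdd.

Record valuation (R : comNzRingType) (L : ordAbGroupType) := Valuation {
  vfun :> R -> wtop L;
  vfun1 : vfun 1 = 0;
  vfun0 : vfun 0 = Infty;
  vfunM : forall a b, vfun (a * b) = vfun a + vfun b;
  vfunD : forall a b, Num.min (vfun a) (vfun b) <= vfun (a + b)
}.

(* The group generated by the finite values: the values themselves need not
   form a group when R is not a field. *)
Definition value_group (R : comNzRingType) (L : ordAbGroupType)
    (mu : valuation R L) : set L :=
  [set alpha | exists f g beta gamma,
     [/\ mu f = Fin beta, mu g = Fin gamma & alpha = beta - gamma]].

(* The graded algebra of mu. An element of the direct sum of the P_a / P_a^+
   is represented by a formal sum of pairs (a, g), with a in the value group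
   and g in P_a, standing for the class of g in degree a; two formal sums are
   identified when, in each degree a, their components differ by an element
   of P_a^+. *)
Section GradedAlgebra.
Variables (R : comNzRingType) (L : ordAbGroupType) (mu : valuation R L).

Lemma vfunN1 : mu (- 1) = 0.
Proof.
have : mu (-1) + mu (-1) = 0 by rewrite -vfunM mulrNN mulr1 vfun1.
case: (mu (-1)) => [a|] // [aa0]; congr Fin.
have mono (x y z : L) : x <= y -> z + x <= z + y by exact: oag_leD2l.
apply/eqP; rewrite eq_le; case/orP: (oag_le_total a 0) => [a0|a0]; rewrite a0 ?andbT /=.
  by have := mono _ _ a a0; rewrite aa0 addr0.
by have := mono _ _ a a0; rewrite aa0 addr0.
Qed.

Lemma vfunN f : mu (- f) = mu f.
Proof. by rewrite -mulN1r vfunM vfunN1 add0r. Qed.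

Definition vgt (a : L) : set R := [set f | Fin a < mu f].
Definition vge (a : L) : set R := [set f | Fin a <= mu f].

Lemma vgt0 a : vgt a 0.
Proof. by rewrite /vgt /= vfun0. Qed.

Lemma vgtD a f g : vgt a f -> vgt a g -> vgt a (f + g).
Proof.
by move=> hf hg; apply: lt_le_trans (vfunD mu f g); rewrite minElt; case: ifP.
Qed.

Lemma vgtN a f : vgt a f -> vgt a (- f).
Proof. by rewrite /vgt /= vfunN. Qed.

Lemma vgt_sum a (I : Type) (s : seq I) (P : pred I) (F : I -> R) :
  (forall i, P i -> vgt a (F i)) -> vgt a (\sum_(i <- s | P i) F i).
Proof. by move=> h; apply: (big_ind (vgt a)) => //; [exact: vgt0|exact: vgtD]. Qed.

Lemma wtop_lt_leD (a b : L) (x y : wtop L) :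
  Fin a < x -> Fin b <= y -> Fin (a + b) < x + y.
Proof.
have mono (u w z : L) : u <= w -> z + u <= z + w by exact: oag_leD2l.
case: x y => [x|] [y|] //; rewrite !lt_def => /andP[xa ax] yb.
have le1 : a + b <= a + y by apply: mono.
have le2 : a + y <= x + y by rewrite !(addrC _ y); apply: mono.
apply/andP; split; last exact: le_trans le1 le2.
apply: contra xa => /eqP[e]; apply/eqP; congr Fin.
have {e} e : a + y = x + y by apply: le_anti; rewrite le2 e le1.
by rewrite -(addrK y x) -e addrK.
Qed.

Lemma vgtM a b f g : vgt a f -> vge b g -> vgt (a + b) (f * g).
Proof. by rewrite /vgt /vge /= vfunM; exact: wtop_lt_leD. Qed.

Lemma wtop_leD (a b : L) (x y : wtop L) :
  Fin a <= x -> Fin b <= y -> Fin (a + b) <= x + y.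
Proof.
have mono (u w z : L) : u <= w -> z + u <= z + w by exact: oag_leD2l.
case: x y => [x|] [y|] // ax yb; apply: (@le_trans _ _ (a + y)); first exact: mono.
by rewrite !(addrC _ y); apply: mono.
Qed.

Lemma mem_value_group0 : value_group mu 0.
Proof. by exists 1, 1, 0, 0; rewrite vfun1 subrr. Qed.

Lemma mem_value_groupD a b :
  value_group mu a -> value_group mu b -> value_group mu (a + b).
Proof.
move=> [f [g [x [y [hf hg ->]]]]] [f' [g' [x' [y' [hf' hg' ->]]]]].
exists (f * f'), (g * g'), (x + x'), (y + y').
by rewrite !vfunM hf hg hf' hg'; split=> //; rewrite opprD addrACA.
Qed.

Definition homogeneous (p : L * R) : bool :=
  `[< value_group mu p.1 /\ vge p.1 p.2 >].

Definition formal_sum := {s : seq (L * R) | all homogeneous s}.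

HB.instance Definition _ := Choice.on formal_sum.

Definition component (s : seq (L * R)) (a : L) : R :=
  \sum_(p <- s | p.1 == a) p.2.

Definition graded_eq (s t : formal_sum) : bool :=
  `[< forall a, vgt a (component (val s) a - component (val t) a) >].

Lemma graded_eqP s t : reflect
  (forall a, vgt a (component (val s) a - component (val t) a)) (graded_eq s t).
Proof. exact: asboolP. Qed.

Lemma graded_eq_refl : reflexive graded_eq.
Proof. by move=> s; apply/graded_eqP => a; rewrite subrr; exact: vgt0. Qed.

Lemma graded_eq_sym : symmetric graded_eq.
Proof.
move=> s t; apply/graded_eqP/graded_eqP => h a; rewrite -opprB; exact: vgtN.
Qed.

Lemma graded_eq_trans : transitive graded_eq.
Proof.
move=> t s u /graded_eqP st /graded_eqP tu; apply/graded_eqP => a.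
by rewrite -(subrK (component (val t) a) (component (val s) a)) -addrA; apply: vgtD.
Qed.

Canonical graded_equiv :=
  EquivRel graded_eq graded_eq_refl graded_eq_sym graded_eq_trans.

Definition graded := {eq_quot graded_eq}.
HB.instance Definition _ := Choice.on graded.
HB.instance Definition _ := EqQuotient.on graded.

Definition seq_opp (s : seq (L * R)) := [seq (p.1, - p.2) | p <- s].
Definition seq_mul (s t : seq (L * R)) :=
  [seq (p.1 + q.1, p.2 * q.2) | p <- s, q <- t].

Lemma fs_zero_subproof : all homogeneous [::]. Proof. by []. Qed.
Definition fs_zero : formal_sum :=
  exist (all homogeneous) [::] fs_zero_subproof.

Lemma fs_one_subproof : all homogeneous [:: (0, 1)].
Proof.
rewrite /= andbT; apply/asboolP; split; first exact: mem_value_group0.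
by rewrite /vge /= vfun1.
Qed.
Definition fs_one : formal_sum :=
  exist (all homogeneous) [:: (0, 1)] fs_one_subproof.

Lemma fs_add_subproof (s t : formal_sum) : all homogeneous (val s ++ val t).
Proof. by rewrite all_cat (valP s) (valP t). Qed.
Definition fs_add (s t : formal_sum) : formal_sum :=
  exist (all homogeneous) _ (fs_add_subproof s t).

Lemma fs_opp_subproof (s : formal_sum) : all homogeneous (seq_opp (val s)).
Proof.
rewrite all_map; apply: sub_all (valP s) => p /asboolP[h1 h2].
by apply/asboolP; split=> //; rewrite /vge /= vfunN.
Qed.
Definition fs_opp (s : formal_sum) : formal_sum :=
  exist (all homogeneous) _ (fs_opp_subproof s).

Lemma fs_mul_subproof (s t : formal_sum) :
  all homogeneous (seq_mul (val s) (val t)).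
Proof.
apply/allP => _ /allpairsP[[p q] /= [ps qt ->]].
have /asboolP[p1 p2] := allP (valP s) _ ps.
have /asboolP[q1 q2] := allP (valP t) _ qt.
apply/asboolP; split => /=; first exact: mem_value_groupD.
by move: p2 q2; rewrite /vge /= vfunM; exact: wtop_leD.
Qed.
Definition fs_mul (s t : formal_sum) : formal_sum :=
  exist (all homogeneous) _ (fs_mul_subproof s t).

Lemma component_cat s t a : component (s ++ t) a = component s a + component t a.
Proof. by rewrite /component big_cat. Qed.

Lemma component_opp s a : component (seq_opp s) a = - component s a.
Proof. by rewrite /component big_map sumrN. Qed.

Lemma component_mul s t a :
  component (seq_mul s t) a = \sum_(q <- t) component s (a - q.1) * q.2.
Proof.
rewrite /component /seq_mul big_mkcond big_allpairs_dep /= exchange_big /=.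
apply: eq_bigr => q _; rewrite mulr_suml [RHS]big_mkcond /=; apply: eq_bigr => p _.
by rewrite (can2_eq (addrK _) (subrK _)).
Qed.

Lemma seq_mulC s t a : component (seq_mul s t) a = component (seq_mul t s) a.
Proof.
rewrite /component /seq_mul big_mkcond [RHS]big_mkcond !big_allpairs_dep /=.
rewrite exchange_big /=; apply: eq_bigr => q _; apply: eq_bigr => p _.
by rewrite addrC mulrC.
Qed.

Lemma pi_graded_eq (s t : formal_sum) :
  (forall a, component (val s) a = component (val t) a) ->
  \pi_graded s = \pi_graded t.
Proof. by move=> h; apply/eqmodP/graded_eqP => a; rewrite h subrr; exact: vgt0. Qed.

Definition gzero : graded := lift_cst graded fs_zero.
Definition gone : graded := lift_cst graded fs_one.
Definition gadd := lift_op2 graded fs_add.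
Definition gopp := lift_op1 graded fs_opp.
Definition gmul := lift_op2 graded fs_mul.

Canonical pi_gzero_morph := PiConst gzero.
Canonical pi_gone_morph := PiConst gone.

Lemma pi_gopp : {morph \pi : x / fs_opp x >-> gopp x}.
Proof.
move=> s; unlock gopp; apply/eqmodP/graded_eqP => a.
have /eqmodP/graded_eqP/(_ a) h : s = repr (\pi_graded s) %[mod graded].
  by rewrite reprK.
by rewrite /= !component_opp -opprD; exact: vgtN.
Qed.
Canonical pi_gopp_morph := PiMorph1 pi_gopp.

Lemma pi_gadd : {morph \pi : x y / fs_add x y >-> gadd x y}.
Proof.
move=> s t; unlock gadd; apply/eqmodP/graded_eqP => a.
have /eqmodP/graded_eqP/(_ a) hs : s = repr (\pi_graded s) %[mod graded].
  by rewrite reprK.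
have /eqmodP/graded_eqP/(_ a) ht : t = repr (\pi_graded t) %[mod graded].
  by rewrite reprK.
by rewrite /= !component_cat opprD addrACA; exact: vgtD.
Qed.
Canonical pi_gadd_morph := PiMorph2 pi_gadd.

Lemma fs_mul_congrl (s s' t : formal_sum) :
  graded_eq s s' -> graded_eq (fs_mul s t) (fs_mul s' t).
Proof.
move/graded_eqP => h; apply/graded_eqP => a.
rewrite /= !component_mul -sumrB big_seq.
apply: vgt_sum => q /(allP (valP t))/asboolP[_ hq].
by rewrite -mulrBl -{1}(subrK q.1 a); exact: vgtM.
Qed.

Lemma fs_mulC (s t : formal_sum) : graded_eq (fs_mul s t) (fs_mul t s).
Proof. by apply/graded_eqP => a; rewrite /= seq_mulC subrr; exact: vgt0. Qed.

Lemma pi_gmul : {morph \pi : x y / fs_mul x y >-> gmul x y}.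
Proof.
move=> s t; unlock gmul; apply/eqmodP.
have /eqmodP hs : s = repr (\pi_graded s) %[mod graded] by rewrite reprK.
have /eqmodP ht : t = repr (\pi_graded t) %[mod graded] by rewrite reprK.
apply: (graded_eq_trans (fs_mul_congrl t hs)).
apply: (graded_eq_trans (fs_mulC _ _)).
by apply: (graded_eq_trans (fs_mul_congrl _ ht)); exact: fs_mulC.
Qed.
Canonical pi_gmul_morph := PiMorph2 pi_gmul.

Lemma gaddA : associative gadd.
Proof.
elim/quotW=> x; elim/quotW=> y; elim/quotW=> z; rewrite !piE.
by apply: pi_graded_eq => a /=; rewrite catA.
Qed.
Lemma gaddC : commutative gadd.
Proof.
elim/quotW=> x; elim/quotW=> y; rewrite !piE.
by apply: pi_graded_eq => a /=; rewrite !component_cat addrC.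
Qed.
Lemma gadd0 : left_id gzero gadd.
Proof. by elim/quotW=> x; rewrite !piE; apply: pi_graded_eq. Qed.
Lemma gaddN : left_inverse gzero gopp gadd.
Proof.
elim/quotW=> x; rewrite !piE; apply: pi_graded_eq => a /=.
by rewrite component_cat component_opp addNr /component big_nil.
Qed.
HB.instance Definition _ :=
  GRing.isZmodule.Build graded gaddA gaddC gadd0 gaddN.

Lemma gmulA : associative gmul.
Proof.
elim/quotW=> x; elim/quotW=> y; elim/quotW=> z; rewrite !piE.
apply: pi_graded_eq => a /=.
rewrite seq_mulC !component_mul.
under eq_bigr do rewrite component_mul mulr_suml.
under [RHS]eq_bigr do rewrite seq_mulC component_mul mulr_suml.
rewrite exchange_big /=; apply: eq_bigr => r _; apply: eq_bigr => q _.
by rewrite -!mulrA [q.2 * _]mulrC addrAC.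
Qed.
Lemma gmulC : commutative gmul.
Proof. by elim/quotW=> x; elim/quotW=> y; rewrite !piE; apply/eqmodP/fs_mulC. Qed.
Lemma gmul1 : left_id gone gmul.
Proof.
elim/quotW=> x; rewrite !piE; apply: pi_graded_eq => a /=.
by rewrite seq_mulC component_mul big_seq1 subr0 mulr1.
Qed.
Lemma gmulDl : left_distributive gmul gadd.
Proof.
elim/quotW=> x; elim/quotW=> y; elim/quotW=> z; rewrite !piE.
apply: pi_graded_eq => a /=.
rewrite component_cat !component_mul -big_split /=.
by apply: eq_bigr => q _; rewrite component_cat mulrDl.
Qed.
Lemma gone_neq0 : gone != 0.
Proof.
apply/negP; rewrite -[0]/gzero !piE => /graded_eqP h.
move: (h 0); rewrite /component big_cons !big_nil /= eqxx addr0 subr0.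
by rewrite /vgt /= vfun1 ltxx.
Qed.
HB.instance Definition _ := GRing.Zmodule_isComNzRing.Build graded
  gmulA gmulC gmul1 gmulDl gone_neq0.

Lemma initial_subproof (g : R) (a : L) :
  mu g = Fin a -> all homogeneous [:: (a, g)].
Proof.
move=> e; rewrite /= andbT; apply/asboolP; split; last by rewrite /vge /= e.
by exists g, 1, a, 0; rewrite vfun1 subr0.
Qed.

Definition initial (g : R) : graded :=
  match mu g as x return mu g = x -> graded with
  | Fin a => fun e => \pi_graded
      (exist (all homogeneous) [:: (a, g)] (initial_subproof e))
  | Infty => fun _ => 0
  end erefl.

Definition mu_equiv (g h : R) : Prop := initial g = initial h.
Definition mu_divides (h g : R) : Prop :=
  exists q : graded, initial g = q * initial h.

End GradedAlgebra.

Definition principal_ideal (R : comNzRingType) (a : R) : {pred R} :=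
  [pred b | `[< exists q, b = q * a >]].

Definition prime_ideal (R : comNzRingType) (I : {pred R}) : Prop :=
  idealr_closed I /\ prime_idealr_closed I.

(* [deg 0] is 0, not -oo: the definitions below only compare degrees of nonzero
   polynomials. *)
Definition deg (R : nzRingType) (f : {poly R}) : nat := (size f).-1.

Section Tree.
Variables (K : fieldType) (G L : ordAbGroupType).
Variables (v : valuation K G) (iota : G -> L).

Record node := Node {
  node_val :> valuation {poly K} L;
  node_ext : forall a : K, node_val a%:P = wtop_map iota (v a)
}.

Definition node_le (mu nu : node) : Prop := forall f, mu f <= nu f.
Definition leaf (mu : node) : Prop := forall nu, node_le mu nu -> nu = mu.
Definition inner (mu : node) : Prop := ~ leaf mu.

Definition mu_irreducible (mu : node) (g : {poly K}) : Prop :=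
  initial mu g != 0 /\ prime_ideal (principal_ideal (initial mu g)).

Definition mu_minimal (mu : node) (g : {poly K}) : Prop :=
  forall f, f != 0 -> (deg f < deg g)%N -> ~ mu_divides mu g f.

Definition KP (mu : node) : set {poly K} :=
  [set g | [/\ g \is monic, mu_minimal mu g & mu_irreducible mu g]].

Definition min_KP (mu : node) : set {poly K} :=
  [set phi | KP mu phi /\ forall psi, KP mu psi -> (deg phi <= deg psi)%N].

(* Degree and singular value, read off an arbitrary element of [min_KP mu];
   the default value 0 of [xget] is only taken when mu is a leaf. *)
Definition deg_node (mu : node) : nat := deg (xget 0 (min_KP mu)).
Definition sv (mu : node) : wtop L := mu (xget 0 (min_KP mu)).

(* nu = [mu; phi, gamma] *)
Definition is_augmentation (nu mu : node) (phi : {poly K}) (gamma : wtop L) :=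
  [/\ KP mu phi, mu phi < gamma
    & forall (n : nat) (a : nat -> {poly K}),
        (forall s, (size (a s) < size phi)%N) ->
        nu (\sum_(s < n) a s * phi ^+ s)
          = \big[Num.min/Infty]_(s < n) (mu (a s) + gamma *+ s)].

Definition value_group0 (mu : node) : set L :=
  [set alpha | exists f, [/\ f != 0, (deg f < deg_node mu)%N & mu f = Fin alpha]].

Definition cosets (A B : set L) : set (set L) :=
  [set [set a + b | b in B] | a in A].

Definition ramification_index_is (mu : node) (e : nat) : Prop :=
  cosets (value_group mu) (value_group0 mu) #= `I_e.

Section Families.
Variables (d : Order.disp_t) (A : orderType d).

(* A totally ordered family of inner nodes without maximal element. *)
Definition inner_family (rho : A -> node) : Prop :=
  [/\ forall i, inner (rho i),
      forall i j, (i <= j)%O <-> node_le (rho i) (rho j)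
    & forall i : A, exists j : A, (i < j)%O].

Definition stable_degrees (rho : A -> node) : set nat :=
  [set m | exists i0, forall i, (i0 <= i)%O -> deg_node (rho i) = m].

Definition continuous_family (rho : A -> node) : Prop :=
  inner_family rho /\ stable_degrees rho !=set0.

Definition stable_degree (rho : A -> node) : nat :=
  xget 0%N (stable_degrees rho).

Definition stable (rho : A -> node) (f : {poly K}) : Prop :=
  exists i, forall j, (i < j)%O -> rho i f = rho j f.

Definition is_stable_value (rho : A -> node) (f : {poly K}) (x : wtop L) :=
  (exists i, rho i f = x) /\ (forall i, rho i f <= x).

(* [xget] returns Infty when every polynomial is stable. *)
Definition unstable_degree (rho : A -> node) : wtop nat :=
  xget Infty [set x | exists f, [/\ f \is monic, ~ stable rho f, x = Fin (deg f)
    & forall g, g \is monic -> ~ stable rho g -> (deg f <= deg g)%N]].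

Definition stable_group (rho : A -> node) : set L :=
  [set alpha | exists f,
     [/\ f != 0, stable rho f & is_stable_value rho f (Fin alpha)]].

Definition well_ordered : Prop :=
  forall S : set A, S !=set0 -> exists2 i, S i & forall j, S j -> (i <= j)%O.

End Families.

Definition equivalent_families (d d' : Order.disp_t) (A : orderType d)
    (B : orderType d') (rho : A -> node) (zeta : B -> node) : Prop :=
  (forall i, exists j, node_le (rho i) (zeta j)) /\
  (forall j, exists i, node_le (zeta j) (rho i)).

End Tree.

(* Main.v *)
Require Import Defs.
From HB Require Import structures.
From mathcomp Require Import all_boot all_order all_algebra.
From mathcomp Require Import generic_quotient ring_quotient.
From mathcomp Require Import boolp classical_sets functions cardinality wochoice.
From mathcomp Require Import ring zify.

Set Implicit Arguments.
Unset Strict Implicit.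
Unset Printing Implicit Defensive.

Import Order.TTheory GRing.Theory.

Local Open Scope classical_set_scope.
Local Open Scope quotient_scope.
Local Open Scope card_scope.
Local Open Scope ring_scope.

(** Let [m] be the stable degree and [rho_0] a node of the family from which on
    all the nodes have degree [m]. For [rho_0 <= rho_i < rho_j], the valuations
    [rho_i] and [rho_j] agree in degree less than [m], because a monic polynomial
    of minimal degree on which two comparable nodes differ is a key polynomial
    for the smaller one ([separates_KP]). A minimal key polynomial [phi_j] of
    [rho_j] satisfies [rho_i (phi_j) < rho_j (phi_j)], for otherwise the formula
    for [rho_j] on [phi_j]-expansions would give [rho_j <= rho_i]. In particular
    the singular values [sv (rho_i) = rho_i (phi_i)] strictly increase
    ([sv_lt]).

    Since [m] is less than the unstable degree, every monic polynomial [chi] of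
    degree [m] has a stable value [x], and [x < sv (rho_j)] for [j] large.
    These values are cofinal in the singular values. When [sv (rho_0) < x], the
    polynomial [chi] is a key polynomial for [rho_0], and the augmentation
    [w = [rho_0; chi, x]] is an inner node: it lies between the nodes [rho_i]
    with [sv (rho_i) < x] and a node [rho_j] with [x < sv (rho_j)]. It does not
    have to belong to the family, whose own nodes may have a larger ramification
    index; but [x = w (phi_j - chi)] is the value of a polynomial of degree
    less than [m], so that the value group of [w] is the group of values in
    degree less than [m], which does not depend on [w]. So the relative ramification
    index of [w] is one, and the value groups of all these nodes coincide.

    The family [zeta] is indexed by a well-ordered cofinal set of such values,
    with one polynomial [chi_x] chosen for each value [x]. For [x < y] the
    difference [chi_y - chi_x] has value [x], in all nodes of the new family.
    Hence [chi_x] and [chi_y] are not equivalent for [zeta_x], the polynomial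
    [chi_y] has value [x] in [zeta_x] and [y] in [zeta_y], so that it is a key
    polynomial for [zeta_x], and [zeta_y = [zeta_x; chi_y, y]].

    Two general facts carry the argument. The ideal generated in the graded
    algebra of [mu] by the initial term of a polynomial that separates [mu] from
    [nu] is the kernel of the map to the graded algebra of [nu], hence prime
    ([kernel_generator_irreducible]). The function defined on [phi]-expansions
    by the augmentation formula is multiplicative ([augM]): by induction on the
    degrees, the constant coefficients being multiplied modulo [phi]. *)

(** * Ordered abelian groups with a largest element *)

Section OagTheory.
Variable L : ordAbGroupType.
Implicit Types a b c : L.

Lemma oagD2l a b c : (a + b <= a + c) = (b <= c).
Proof.
apply/idP/idP => [h|]; last exact: oag_leD2l.
by have := oag_leD2l _ _ (- a) h; rewrite !addKr.
Qed.

Lemma oagltD2l a b c : (a + b < a + c) = (b < c).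
Proof. by rewrite !lt_def oagD2l (inj_eq (addrI a)). Qed.

Lemma oagD2r a b c : (b + a <= c + a) = (b <= c).
Proof. by rewrite ![_ + a]addrC oagD2l. Qed.

Lemma oagltD2r a b c : (b + a < c + a) = (b < c).
Proof. by rewrite ![_ + a]addrC oagltD2l. Qed.

Lemma oag_leD a b c e : a <= b -> c <= e -> a + c <= b + e.
Proof. by move=> ab ce; apply: (@le_trans _ _ (a + e)); rewrite ?oagD2l ?oagD2r. Qed.

Lemma oag_ltleD a b c e : a < b -> c <= e -> a + c < b + e.
Proof. by move=> ab ce; apply: (@le_lt_trans _ _ (a + e)); rewrite ?oagD2l ?oagltD2r. Qed.

Lemma oag_leNgt a b : (a <= b) = ~~ (b < a).
Proof.
rewrite lt_def; case/orP: (oag_le_total a b) => h.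
  by rewrite h; apply/esym/negP => /andP[/eqP n h']; apply: n; apply/le_anti/andP.
by rewrite h andbT negbK; apply/idP/eqP => [h'|->//]; apply/le_anti/andP.
Qed.

Lemma wtop_le_total : total (<=%R : rel (wtop L)).
Proof. by move=> [a|] [b|] //; apply: oag_le_total. Qed.

(** The total order gives access to the theory of minima. *)
HB.instance Definition _ := Order.POrder_isTotal.Build _ (wtop L) wtop_le_total.

Implicit Types x y z t : wtop L.

Lemma lt_FinE a b : (Fin a < Fin b :> wtop L) = (a < b).
Proof. by rewrite !lt_def. Qed.

Lemma ltInfty x : (x < Infty) = (x != Infty).
Proof. by case: x. Qed.

Lemma leInfty x : x <= Infty.
Proof. by case: x. Qed.

Lemma Inftyle x : (Infty <= x) = (x == Infty).
Proof. by case: x. Qed.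

Lemma addInfty x : x + Infty = Infty.
Proof. by case: x. Qed.

Lemma FinD a b : Fin (a + b) = Fin a + Fin b :> wtop L.
Proof. by []. Qed.

Lemma wtop_le_add x y z t : x <= y -> z <= t -> x + z <= y + t.
Proof.
case: x y z t => [a|] [b|] [c|] [e|] //; exact: oag_leD.
Qed.

Lemma wtop_lt_add x y z t : t != Infty \/ z != Infty ->
  x < y -> z <= t -> x + z < y + t.
Proof.
case: x y z t => [a|] [b|] [c|] [e|] //; try by case.
by move=> _; rewrite !lt_FinE; apply: oag_ltleD.
Qed.

Lemma wtop_addKr a x : Fin (- a) + (Fin a + x) = x.
Proof. by case: x => [b|] //; congr Fin; rewrite addKr. Qed.

Lemma wtop_add_min x y z : x + Num.min y z = Num.min (x + y) (x + z).
Proof.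
case: (leP y z) => h; first by rewrite (min_idPl _) // wtop_le_add.
by rewrite (min_idPr _) // wtop_le_add // ltW.
Qed.

Lemma wtop_add_eqInfty x y : (x + y == Infty) = (x == Infty) || (y == Infty).
Proof. by case: x y => [a|] [b|]. Qed.

Lemma wtop_finP x : reflect (exists a, x = Fin a) (x != Infty).
Proof. by case: x => [a|]; constructor; [exists a | case]. Qed.

End OagTheory.

(** * Elementary properties of valuations *)

Section Valuations.
Variables (R : comNzRingType) (L : ordAbGroupType).
Implicit Types (mu nu : valuation R L) (f g : R).

Lemma vfun_subC mu f g : mu (f - g) = mu (g - f).
Proof. by rewrite -vfunN opprB. Qed.

Lemma vfun_leD mu x f g : x <= mu f -> x <= mu g -> x <= mu (f + g).
Proof. by move=> hf hg; apply: le_trans (vfunD mu f g); rewrite le_min hf. Qed.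

Lemma vfun_ltD mu x f g : x < mu f -> x < mu g -> x < mu (f + g).
Proof. by move=> hf hg; apply: lt_le_trans (vfunD mu f g); rewrite lt_min hf. Qed.

Lemma vfun_leB mu x f g : x <= mu f -> x <= mu g -> x <= mu (f - g).
Proof. by move=> hf hg; apply: vfun_leD; rewrite ?vfunN. Qed.

Lemma vfun_ltB mu x f g : x < mu f -> x < mu g -> x < mu (f - g).
Proof. by move=> hf hg; apply: vfun_ltD; rewrite ?vfunN. Qed.

Lemma vfunD_lt mu f g : mu f < mu g -> mu (f + g) = mu f.
Proof.
move=> h; apply/le_anti/andP; split; last by apply: vfun_leD => //; apply: ltW.
rewrite leNgt; apply/negP => h'.
by have := vfun_ltB h' h; rewrite addrK ltxx.
Qed.

Lemma vfunB_lt mu f g : mu f < mu g -> mu (f - g) = mu f.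
Proof. by move=> h; rewrite vfunD_lt // vfunN. Qed.

Lemma vfunB_gt mu f g : mu g < mu f -> mu (f - g) = mu g.
Proof. by move=> h; rewrite vfun_subC vfunB_lt. Qed.

Lemma vfunD_neq mu f g : mu f != mu g -> mu (f + g) = Num.min (mu f) (mu g).
Proof.
by case: ltgtP => // h _; [rewrite vfunD_lt|rewrite addrC vfunD_lt].
Qed.

Lemma vfunD_gt_eq mu f g : Num.min (mu f) (mu g) < mu (f + g) -> mu f = mu g.
Proof. by move=> h; apply/eqP; apply: contraTT h => /vfunD_neq ->; rewrite ltxx. Qed.

Lemma value_groupB mu a b :
  value_group mu a -> value_group mu b -> value_group mu (a - b).
Proof.
move=> ha [f [g [x [y [hf hg ->]]]]]; rewrite opprB.
by apply: mem_value_groupD => //; exists g, f, y, x.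
Qed.

Lemma mem_value_group mu f a : mu f = Fin a -> value_group mu a.
Proof. by move=> e; exists f, 1, a, 0; rewrite vfun1 subr0. Qed.

End Valuations.

(** * Divisibility and prime ideals in the graded algebra *)

Section GradedTheory.
Variables (R : comNzRingType) (L : ordAbGroupType) (mu : valuation R L).
Implicit Types (f g h : R) (a b : L) (s t : formal_sum mu).

Lemma initialE g a (e : mu g = Fin a) :
  initial mu g = \pi_(graded mu) (exist _ [:: (a, g)] (initial_subproof e)).
Proof.
rewrite /initial.
suff H x (ex : mu g = x) : x = Fin a ->
    match x as x return mu g = x -> graded mu with
    | Fin a => fun e => \pi_(graded mu)
        (exist (all (homogeneous mu)) [:: (a, g)] (initial_subproof e))
    | Infty => fun _ => 0
    end ex = \pi_(graded mu) (exist _ [:: (a, g)] (initial_subproof e)) by exact: H.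
case: x ex => // b eb [ba]; move: eb; rewrite ba => eb.
by rewrite (bool_irrelevance (initial_subproof eb) (initial_subproof e)).
Qed.

Lemma pi_gradedP s t : \pi_(graded mu) s = \pi_(graded mu) t <->
  forall a, vgt mu a (component (val s) a - component (val t) a).
Proof. by split=> [/eqmodP/graded_eqP|h] //; apply/eqmodP/graded_eqP. Qed.

Lemma mul_pi_graded s t :
  \pi_(graded mu) s * \pi_(graded mu) t = \pi_(graded mu) (fs_mul s t).
Proof. exact: esym (pi_gmul s t). Qed.

Lemma pi_graded_one : 1 = \pi_(graded mu) (fs_one mu).
Proof. by rewrite -[LHS]/(gone mu) piE. Qed.

Lemma pi_graded_zero : 0 = \pi_(graded mu) (fs_zero mu).
Proof. by rewrite -[LHS]/(gzero mu) piE. Qed.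

Lemma component1 a g c : component [:: (a, g)] c = if a == c then g else 0.
Proof. by rewrite /component big_cons big_nil /= addr0. Qed.

Lemma component_mul1 (s : seq (L * R)) b h a :
  component (seq_mul s [:: (b, h)]) a = component s (a - b) * h.
Proof. by rewrite component_mul big_seq1. Qed.

Lemma vge_component s a : Fin a <= mu (component (val s) a).
Proof.
rewrite /component big_seq_cond.
apply: (big_ind (fun f => Fin a <= mu f)).
- by rewrite vfun0.
- by move=> f g; apply: vfun_leD.
- by move=> p /andP[ps /eqP <-]; have /asboolP[] := allP (valP s) _ ps.
Qed.

Lemma value_group_degree s p : p \in val s -> value_group mu p.1.
Proof. by move=> ps; have /asboolP[] := allP (valP s) _ ps. Qed.

Lemma component_notin (s : seq (L * R)) a :
  a \notin [seq p.1 | p <- s] -> component s a = 0.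
Proof.
move=> h; rewrite /component big_seq_cond big_pred0 // => p.
by apply: contraNF h => /andP[ps /eqP <-]; apply: map_f.
Qed.

Lemma component_map (ds : seq L) (q : L -> R) a : uniq ds ->
  component [seq (d, q d) | d <- ds] a = if a \in ds then q a else 0.
Proof.
move=> u; rewrite /component big_map /=.
case: ifP => h; last first.
  by rewrite big_seq_cond big_pred0 // => d; apply: contraFF h => /andP[? /eqP <-].
by rewrite -big_filter filter_pred1_uniq // big_seq1.
Qed.

(** The components of a product as a convolution over distinct degrees. *)
Lemma component_mul_degree (s t : seq (L * R)) a : component (seq_mul s t) a =
  \sum_(b <- undup [seq q.1 | q <- t]) component s (a - b) * component t b.
Proof.
rewrite component_mul; under [RHS]eq_bigr do rewrite [X in _ * X]/component mulr_sumr big_mkcond /=.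
rewrite exchange_big /= big_seq [RHS]big_seq; apply: eq_bigr => q qt.
rewrite (bigD1_seq q.1) ?undup_uniq ?mem_undup ?map_f //= eqxx.
by rewrite big1 ?addr0 // => b; rewrite eq_sym => /negPf ->.
Qed.

Lemma initial_eqP f g a : mu f = Fin a -> mu g = Fin a ->
  (mu_equiv mu f g <-> Fin a < mu (f - g)).
Proof.
move=> ef eg; rewrite /mu_equiv (initialE ef) (initialE eg) pi_gradedP /=; split.
  by move/(_ a); rewrite !component1 eqxx.
move=> h c; rewrite !component1; case: eqP => [<- //|_].
by rewrite subrr; apply: vgt0.
Qed.

Lemma mu_dividesP f h a b : mu f = Fin a -> mu h = Fin b ->
  (mu_divides mu h f <-> exists c, Fin a < mu (f - c * h)).
Proof.
move=> ef eh; rewrite /mu_divides (initialE ef) (initialE eh); split.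
  case; elim/quotW => s; rewrite mul_pi_graded => /pi_gradedP /(_ a) /=.
  by rewrite component1 component_mul1 eqxx => h'; exists (component (val s) (a - b)).
case=> c hc.
have ech : mu (c * h) = Fin a.
  by rewrite -[c * h](subKr f) vfunB_lt ef.
have ec : mu c = Fin (a - b).
  by move: ech; rewrite vfunM eh; case: (mu c) => // x [<-]; rewrite addrK.
exists (\pi_(graded mu) (exist _ [:: (a - b, c)] (initial_subproof ec))).
rewrite mul_pi_graded; apply/pi_gradedP => x /=.
rewrite component_mul1 !component1 (can2_eq (subrK _) (addrK _)) subrK.
by case: eqP => [<- //|_]; rewrite mul0r subrr; apply: vgt0.
Qed.

End GradedTheory.

Lemma exists_max_degree (L : ordAbGroupType) (P : L -> Prop) (s : seq L) a0 :
  a0 \in s -> P a0 ->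
  exists a, [/\ a \in s, P a & forall b, b \in s -> P b -> b <= a].
Proof.
elim: s a0 => // x s IH a0 a0s Pa0.
have [[b bs Pb]|no] := pselect (exists2 b, b \in s & P b).
  have [a [as_ Pa amax]] := IH b bs Pb.
  have [[Px xa]|nx] := pselect (P x /\ a < x).
    exists x; split=> //; first by rewrite mem_head.
    move=> c; rewrite inE => /orP[/eqP->//|cs Pc].
    by apply: le_trans (ltW xa); apply: amax.
  exists a; split=> //; first by rewrite inE as_ orbT.
  move=> c; rewrite inE => /orP[/eqP-> Px|]; last exact: amax.
  by rewrite oag_leNgt; apply/negP => ax; apply: nx.
exists x; move: a0s; rewrite inE => /orP[/eqP e|a0s]; last by case: no; exists a0.
split; [exact: mem_head|by rewrite -e|move=> c; rewrite inE => /orP[/eqP-> //|cs Pc]].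
by case: no; exists c.
Qed.

(** Suppose that [mu <= nu], that [mu h < nu h], and that an element whose
    [nu]-value exceeds a lower bound of its [mu]-value is, modulo larger
    [mu]-values, a multiple of [h]. Then the kernel of the map of graded algebras
    induced by [mu <= nu] is generated by the initial term of [h]; it is prime,
    because a product of two elements outside of the kernel has a nonzero
    component in degree [a + b], where [a] and [b] are the largest degrees in
    which the factors are outside of the kernel. *)
Section PrimeKernel.
Variables (R : comNzRingType) (L : ordAbGroupType) (mu nu : valuation R L).
Variable h : R.
Hypothesis le_mu_nu : forall f, mu f <= nu f.
Hypothesis lt_h : mu h < nu h.
Hypothesis div_h : forall a f, Fin a <= mu f -> Fin a < nu f ->
  exists c, Fin a < mu (f - c * h).

Lemma finite_h : exists b, mu h = Fin b.
Proof. by apply/wtop_finP; apply: contraTneq lt_h => ->; rewrite -leNgt leInfty. Qed.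

(** The ideal generated by the initial term of [h] is the set of classes all of
    whose components have a [nu]-value larger than their degree. *)
Lemma principal_kernelP (s : formal_sum mu) :
  (\pi_(graded mu) s \in principal_ideal (initial mu h)) <->
  (forall a, Fin a < nu (component (val s) a)).
Proof.
have [b eh] := finite_h; rewrite (initialE eh); split.
  move=> /asboolP[]; elim/quotW => t; rewrite mul_pi_graded => /pi_gradedP st a.
  have {st} := st a; rewrite /= component_mul1 /vgt /= => st.
  rewrite -(subrK (component (val t) (a - b) * h) (component _ a)).
  apply: vfun_ltD; first exact: lt_le_trans st (le_mu_nu _).
  rewrite vfunM -[a in Fin a](subrK b) addrC FinD [X in _ < X]addrC.
  apply: wtop_lt_add; [by right|by rewrite -eh|].
  by apply: le_trans (vge_component t _) (le_mu_nu _).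
(* Dividing each component by [h] gives a formal sum whose product with the
   initial term of [h] has the components of [s], modulo larger values. *)
move=> hs; pose ds := undup [seq p.1 | p <- val s].
have /choice[q hq] (a : L) : exists c, Fin a < mu (component (val s) a - c * h).
  by apply: div_h; [exact: vge_component|exact: hs].
pose ds' := [seq d - b | d <- ds]; pose q' d := q (d + b).
have Hhom : all (homogeneous mu) [seq (d, q' d) | d <- ds'].
  apply/allP => _ /mapP[_ /mapP[d dds ->] ->]; apply/asboolP; split => /=.
    apply: value_groupB; last exact: mem_value_group eh.
    by move: dds; rewrite mem_undup => /mapP[p ps ->]; apply: value_group_degree ps.
  rewrite /q' subrK /vge /=.
  have : Fin d <= mu (q d * h).
    have := vfun_leB (vge_component s d) (ltW (hq d)).
    by rewrite subKr.
  rewrite vfunM eh; case: (mu (q d)) => // x; rewrite /Order.le /= => dx.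
  by rewrite -(oagD2r b) subrK.
apply/asboolP; exists (\pi_(graded mu) (exist (all (homogeneous mu)) _ Hhom)).
rewrite mul_pi_graded; apply/pi_gradedP => a /=.
rewrite component_mul1 component_map; last first.
  by rewrite map_inj_uniq ?undup_uniq //; apply: addIr.
rewrite (mem_map (addIr (- b))).
case: ifP => ad; first by rewrite /q' subrK; apply: hq.
rewrite component_notin; first by rewrite mul0r subrr; apply: vgt0.
by rewrite -mem_undup ad.
Qed.

Lemma principal_kernel_idealr_closed :
  idealr_closed (principal_ideal (initial mu h)).
Proof.
split.
- by apply/asboolP; exists 0; rewrite mul0r.
- apply/negP; rewrite pi_graded_one => /principal_kernelP /(_ 0) /=.
  by rewrite component1 eqxx vfun1 ltxx.
- move=> x u w /asboolP[q ->] /asboolP[q' ->].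
  by apply/asboolP; exists (x * q + q'); rewrite mulrDl mulrA.
Qed.

(** A class outside of the kernel has a largest degree witnessing it. *)
Lemma kernel_notin_max (s : formal_sum mu) :
  \pi_(graded mu) s \notin principal_ideal (initial mu h) ->
  exists a, nu (component (val s) a) <= Fin a /\
    forall b, a < b -> Fin b < nu (component (val s) b).
Proof.
move=> /negP ns.
have [a0 ha0] : exists a, nu (component (val s) a) <= Fin a.
  apply: contrapT => no; apply: ns; apply/principal_kernelP => a.
  by rewrite ltNge; apply/negP => ha; apply: no; exists a.
pose P a := nu (component (val s) a) <= Fin a.
have inP a : P a -> a \in [seq p.1 | p <- val s].
  by apply: contraTT => /component_notin; rewrite /P => ->; rewrite vfun0.
have [a [_ Pa amax]] := exists_max_degree (P := P) (inP _ ha0) ha0.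
exists a; split=> // b ab; rewrite ltNge; apply: contraTN ab => Pb.
by rewrite -oag_leNgt; apply: amax => //; apply: inP.
Qed.

Lemma principal_kernel_prime : prime_idealr_closed (principal_ideal (initial mu h)).
Proof.
elim/quotW => s; elim/quotW => t; rewrite mul_pi_graded => /principal_kernelP st.
apply: contrapT => /negP; rewrite negb_or => /andP[/kernel_notin_max[a [sa smax]]].
move=> /kernel_notin_max[b [tb tmax]]; have := st (a + b).
rewrite ltNge /= component_mul_degree => /negP; apply.
have nu_s c : Fin c <= nu (component (val s) c).
  exact: le_trans (vge_component s c) (le_mu_nu _).
have nu_t c : Fin c <= nu (component (val t) c).
  exact: le_trans (vge_component t c) (le_mu_nu _).
have lead : nu (component (val s) a * component (val t) b) <= Fin (a + b).
  by rewrite vfunM FinD; apply: wtop_le_add.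
have bt : b \in undup [seq q.1 | q <- val t].
  rewrite mem_undup; apply: contraTT tb => /component_notin ->.
  by rewrite vfun0.
(* The other terms of the convolution have a factor in a degree larger than
   [a] or [b], whose [nu]-value exceeds this degree. *)
rewrite (bigD1_seq b) ?undup_uniq //= addrK.
rewrite vfunD_lt //; apply: le_lt_trans lead _.
apply: (big_ind (fun f => Fin (a + b) < nu f)).
- by rewrite vfun0.
- by move=> f g; apply: vfun_ltD.
move=> c cb; rewrite vfunM; case: (boolP (c < b)) => hc.
  rewrite -[X in Fin X](subrK c) FinD; apply: wtop_lt_add; [by right| |exact: nu_t].
  by apply: smax; rewrite -addrA -[X in X < _]addr0 oagltD2l -(subrr c) oagltD2r.
rewrite -[X in Fin X](subrK c) addrC FinD [X in _ < X]addrC.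
apply: wtop_lt_add; [by right| |exact: nu_s].
by apply: tmax; rewrite lt_def cb /= oag_leNgt.
Qed.

Lemma kernel_generator_irreducible : initial mu h != 0 /\
  prime_ideal (principal_ideal (initial mu h)).
Proof.
split; last by split; [exact: principal_kernel_idealr_closed|exact: principal_kernel_prime].
have [b eh] := finite_h; rewrite (initialE eh).
apply/eqP; rewrite pi_graded_zero => /pi_gradedP /(_ b).
by rewrite /= component1 eqxx /component big_nil subr0 /vgt /= eh ltxx.
Qed.

End PrimeKernel.

(** * Key polynomials separating two nodes *)

Section Nodes.
Variables (K : fieldType) (G L : ordAbGroupType).
Variables (v : valuation K G) (iota : G -> L).
Implicit Types (mu nu w : node v iota) (phi f g q r : {poly K}).
Implicit Types gamma x y : wtop L.

Lemma node_polyC mu nu (c : K) : mu c%:P = nu c%:P.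
Proof. by rewrite !node_ext. Qed.

Lemma node_polyC_fin mu (c : K) : c != 0 -> mu c%:P != Infty.
Proof.
move=> c0; have : mu c%:P + mu c^-1%:P != Infty.
  by rewrite -vfunM -polyCM divff // vfun1.
by rewrite wtop_add_eqInfty negb_or => /andP[].
Qed.

Lemma deg_lt_size f g : f != 0 -> (size f < size g)%N -> (deg f < deg g)%N.
Proof. by rewrite -size_poly_gt0 /deg; case: (size f) (size g) => [|k] [|n]. Qed.

Lemma size_lt_of_deg f g : (deg f < deg g)%N -> (size f < size g)%N.
Proof. by rewrite /deg; case: (size f) (size g) => [|k] [|n]. Qed.

Lemma node_lt_mul mu nu phi q : node_le mu nu -> mu phi < nu phi ->
  mu (q * phi) != Infty -> mu (q * phi) < nu (q * phi).
Proof.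
move=> le lt; rewrite !vfunM wtop_add_eqInfty negb_or => /andP[q1 p1].
by rewrite addrC [X in _ < X]addrC; apply: wtop_lt_add => //; right.
Qed.

(** A monic polynomial of minimal degree on which [mu] and [nu] differ, for
    nodes [mu <= nu]. *)
Definition separates mu nu phi : Prop :=
  [/\ phi \is monic, node_le mu nu, mu phi < nu phi
    & forall f, (size f < size phi)%N -> mu f = nu f].

Lemma exists_separates mu nu f : node_le mu nu -> mu f < nu f ->
  exists phi, separates mu nu phi.
Proof.
move=> le ltf; pose P n := `[< exists2 g : {poly K}, size g = n & mu g < nu g >].
have exP : exists n, P n by exists (size f); apply/asboolP; exists f.
case: (ex_minnP exP) => n /asboolP[g sg ltg] nmin.
have g0 : g != 0 by apply: contraTneq ltg => ->; rewrite !vfun0 ltxx.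
have lc0 : (lead_coef g)^-1 != 0 by rewrite invr_eq0 lead_coef_eq0.
exists ((lead_coef g)^-1 *: g); split=> //.
- by rewrite monicE lead_coefZ mulVf // lead_coef_eq0.
- rewrite -mul_polyC mulrC; rewrite !vfunM (node_polyC nu mu).
  by apply: wtop_lt_add => //; right; apply: node_polyC_fin.
- move=> h; rewrite size_scale // sg => sh; apply/eqP.
  rewrite eq_le le leNgt; apply/negP => lth.
  have /nmin : P (size h) by apply/asboolP; exists h.
  by rewrite leqNgt sh.
Qed.

Lemma vfun_addInfty mu f g : mu f = Infty -> mu (f + g) = mu g.
Proof.
move=> ef; case: (eqVneq (mu g) Infty) => [eg|ng].
  by apply/eqP; rewrite eg -Inftyle; apply: vfun_leD; rewrite ?ef ?eg.
by rewrite addrC vfunD_lt // ef ltInfty.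
Qed.

Lemma separates_neq0 mu nu phi : separates mu nu phi -> phi != 0.
Proof. by case=> /monic_neq0. Qed.

Lemma separates_size mu nu phi : separates mu nu phi -> (1 < size phi)%N.
Proof.
case=> mphi _ lt _; rewrite ltnNge; apply: contraTN lt => s1.
by rewrite (size1_polyC s1) -leNgt (node_polyC mu nu).
Qed.

Lemma separates_fin_phi mu nu phi : separates mu nu phi -> mu phi != Infty.
Proof. by case=> _ _ lt _; apply: contraTneq lt => ->; rewrite -leNgt leInfty. Qed.

(** Below the degree of [phi] no nonzero polynomial lies in the support of [mu]:
    otherwise [phi] could be replaced by its remainder modulo that polynomial. *)
Lemma separates_fin mu nu phi f : separates mu nu phi ->
  f != 0 -> (size f < size phi)%N -> mu f != Infty.
Proof.
move=> sep f0 sf; case: (sep) => _ _ lt agree; apply/eqP => mf.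
have nf : nu f = Infty by rewrite -agree.
move: lt; rewrite (divp_eq phi f) !vfun_addInfty ?vfunM ?mf ?nf ?addInfty //.
by rewrite agree ?ltxx // (ltn_trans _ sf) // ltn_modp.
Qed.

(** If [f] is in the kernel of the map of graded algebras induced by
    [mu <= nu], then its initial term is a multiple of that of [phi]. *)
Lemma separates_modp mu nu phi f (a : L) : separates mu nu phi ->
  Fin a <= mu f -> Fin a < nu f -> Fin a < mu (f %% phi).
Proof.
move=> sep af af'; have phi0 := separates_neq0 sep.
case: (sep) => _ le lt agree; rewrite ltNge; apply/negP => ra.
have er : mu (f %% phi) = nu (f %% phi) by rewrite agree // ltn_modp.
have eq : f %/ phi * phi = f - f %% phi.
  by rewrite {2}(divp_eq f phi) addrK.
have nq : nu (f %/ phi * phi) = mu (f %% phi).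
  by rewrite eq vfunB_gt -er //; apply: le_lt_trans ra af'.
have ltq : mu (f %/ phi * phi) < mu (f %% phi).
  rewrite -nq; apply: node_lt_mul => //.
  apply: contraTneq ra => e; rewrite -ltNge -nq.
  by have := le (f %/ phi * phi); rewrite e Inftyle => /eqP ->.
move: af; rewrite (divp_eq f phi) vfunD_lt // leNgt.
by rewrite (lt_le_trans ltq).
Qed.

Lemma separates_irreducible mu nu phi : separates mu nu phi ->
  mu_irreducible mu phi.
Proof.
move=> sep; case: (sep) => _ le lt _.
apply: (kernel_generator_irreducible (nu := nu)) => // a f af af'.
exists (f %/ phi); rewrite {1}(divp_eq f phi) addrC addKr.
exact: separates_modp sep _ _.
Qed.

Lemma separates_minimal mu nu phi : separates mu nu phi -> mu_minimal mu phi.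
Proof.
move=> sep f f0 /size_lt_of_deg sf; case: (sep) => _ le lt agree.
have /wtop_finP[a ea] := separates_fin sep f0 sf.
have /wtop_finP[b eb] := separates_fin_phi sep.
move=> /(mu_dividesP ea eb)[c hc].
have ec : mu (c * phi) = Fin a by rewrite -[c * phi](subKr f) vfunB_lt ea.
have : Fin a < nu f.
  rewrite -(subrK (c * phi) f); apply: vfun_ltD; first exact: lt_le_trans hc (le _).
  by rewrite -ec; apply: node_lt_mul; rewrite ?ec.
by rewrite -agree // ea ltxx.
Qed.

Lemma separates_KP mu nu phi : separates mu nu phi -> KP mu phi.
Proof.
move=> sep; split; first by case: sep.
- exact: separates_minimal sep.
- exact: separates_irreducible sep.
Qed.

(** A strict inequality would make [r] divisible by [phi] in the graded
    algebra. *)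
Lemma mu_minimal_divp mu phi q r : mu_minimal mu phi -> (size r < size phi)%N ->
  mu (q * phi + r) = Num.min (mu (q * phi)) (mu r).
Proof.
move=> min sr; apply/eqP; rewrite eq_le vfunD andbT leNgt; apply/negP => lt.
have r0 : r != 0.
  by apply: contraTneq lt => ->; rewrite vfun0 addr0 (min_idPl _) ?ltxx ?leInfty.
have e := vfunD_gt_eq lt; move: lt; rewrite e minxx => lt.
have /wtop_finP[a ea] : mu r != Infty.
  by apply: contraTneq lt => ->; rewrite -leNgt leInfty.
have /wtop_finP[b eb] : mu phi != Infty.
  by move: e; rewrite vfunM ea; case: (mu phi) => //; rewrite addInfty.
apply: (min r r0 (deg_lt_size r0 sr)); apply/(mu_dividesP ea eb).
by exists (- q); rewrite mulNr opprK -ea addrC.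
Qed.

(** * The augmentation function *)

(** [aug w0 phi gamma] sends the [phi]-expansion with coefficients [a_s] to the
    minimum of [w0 (a_s) + s gamma]; it is computed by repeated division by
    [phi], with the size of the polynomial as a bound on the number of steps. *)
Fixpoint aug_rec (w0 : {poly K} -> wtop L) phi gamma n f : wtop L :=
  if n is n'.+1 then
    Num.min (w0 (f %% phi)) (gamma + aug_rec w0 phi gamma n' (f %/ phi))
  else Infty.

Definition aug (w0 : {poly K} -> wtop L) phi gamma f : wtop L :=
  aug_rec w0 phi gamma (size f) f.

Lemma size_divp_lt phi f : (1 < size phi)%N -> f != 0 ->
  (size (f %/ phi)%R < size f)%N.
Proof.
move=> s1 f0; rewrite size_divp -?size_poly_gt0 ?(ltn_trans _ s1) //.
move: f0; rewrite -size_poly_gt0; case: (size phi) s1 => [|[|n]] // _.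
by case: (size f) => // k _; rewrite subSS ltnS leq_subr.
Qed.

(** Induction along the [phi]-expansion. *)
Lemma expansion_ind phi (P : {poly K} -> Prop) : (1 < size phi)%N -> P 0 ->
  (forall q r, (size r < size phi)%N -> P q -> P (q * phi + r)) -> forall f, P f.
Proof.
move=> s1 P0 PS f; have [n] := ubnP (size f); elim: n f => // n IH f sf.
have [->//|f0] := eqVneq f 0; rewrite (divp_eq f phi); apply: PS.
  by rewrite ltn_modp -size_poly_gt0 (ltn_trans _ s1).
by apply: IH; apply: leq_trans (size_divp_lt s1 f0) _.
Qed.

Section AugBasic.
Variables (w0 : {poly K} -> wtop L) (phi : {poly K}) (gamma : wtop L).
Hypotheses (s1 : (1 < size phi)%N) (w00 : w0 0 = Infty).

Lemma aug_rec0 n : aug_rec w0 phi gamma n 0 = Infty.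
Proof. by elim: n => //= n IH; rewrite mod0p div0p IH w00 addInfty minxx. Qed.

Lemma aug_rec_size n k f : (size f <= n)%N -> (size f <= k)%N ->
  aug_rec w0 phi gamma n f = aug_rec w0 phi gamma k f.
Proof.
elim: n k f => [|n IH] k f.
  by rewrite leqn0 size_poly_eq0 => /eqP -> _; rewrite !aug_rec0.
case: k => [|k]; first by rewrite leqn0 size_poly_eq0 => _ /eqP ->; rewrite !aug_rec0.
have [->|f0] := eqVneq f 0; first by rewrite !aug_rec0.
move=> sn sk /=; rewrite (IH k) // -ltnS;
  exact: leq_trans (size_divp_lt s1 f0) _.
Qed.

Lemma augE f : aug w0 phi gamma f =
  Num.min (w0 (f %% phi)) (gamma + aug w0 phi gamma (f %/ phi)).
Proof.
rewrite {1}/aug (@aug_rec_size _ (size f).+1) //=.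
by rewrite (@aug_rec_size (size f) (size (f %/ phi)%R)) // leq_divp.
Qed.

Lemma aug_expand q r : (size r < size phi)%N ->
  aug w0 phi gamma (q * phi + r) = Num.min (w0 r) (gamma + aug w0 phi gamma q).
Proof.
by move=> sr; rewrite augE modp_addl_mul_small // divp_addl_mul_small.
Qed.

Lemma aug0 : aug w0 phi gamma 0 = Infty.
Proof. by rewrite /aug size_poly0. Qed.

Lemma aug_small r : (size r < size phi)%N -> aug w0 phi gamma r = w0 r.
Proof.
move=> sr; rewrite -[r in LHS]add0r -(mul0r phi) aug_expand // aug0 addInfty.
by rewrite (min_idPl _) ?leInfty.
Qed.

Lemma aug_mul_phi q : aug w0 phi gamma (q * phi) = gamma + aug w0 phi gamma q.
Proof.
rewrite -[q * phi]addr0 aug_expand ?size_poly0 ?(ltn_trans _ s1) // w00.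
by rewrite (min_idPr _) ?leInfty.
Qed.

Lemma aug_phi : w0 1 = 0 -> aug w0 phi gamma phi = gamma.
Proof.
move=> w1; have := aug_mul_phi 1; rewrite mul1r => ->.
by rewrite aug_small ?size_poly1 // w1 addr0.
Qed.

Lemma aug_le (nu : valuation {poly K} L) f :
  (forall r, (size r < size phi)%N -> w0 r <= nu r) -> gamma <= nu phi ->
  aug w0 phi gamma f <= nu f.
Proof.
move=> le0 le1; move: f; apply: (expansion_ind s1) => [|q r sr IH]; first by rewrite vfun0 leInfty.
rewrite aug_expand //; apply: vfun_leD; rewrite ge_min ?le0 //.
by rewrite vfunM addrC wtop_le_add ?orbT.
Qed.

Lemma aug_bigmin n (a : nat -> {poly K}) :
  (forall s, (size (a s) < size phi)%N) ->
  aug w0 phi gamma (\sum_(s < n) a s * phi ^+ s) =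
    \big[Num.min/Infty]_(s < n) (w0 (a s) + gamma *+ s).
Proof.
have add_big (k : nat) (F : nat -> wtop L) :
    gamma + \big[Num.min/Infty]_(s < k) F s = \big[Num.min/Infty]_(s < k) (gamma + F s).
  elim: k F => [|k IH] F; first by rewrite !big_ord0 addInfty.
  by rewrite !big_ord_recl wtop_add_min /= (IH (fun i => F i.+1)).
elim: n a => [|n IH] a sa; first by rewrite !big_ord0 aug0.
rewrite !big_ord_recl expr0 mulr1 mulr0n addr0.
under eq_bigr do rewrite /= /bump /= add1n exprSr mulrA.
rewrite -mulr_suml addrC aug_expand // (IH (fun s => a s.+1)) //.
rewrite (add_big n (fun s => w0 (a s.+1) + gamma *+ s)); congr Num.min.
by apply: eq_bigr => i _; rewrite /= /bump /= add1n mulrS addrCA.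
Qed.

End AugBasic.

(** A valuation is computed on the expansions with respect to any of its
    minimal polynomials. *)
Lemma mu_minimal_aug mu phi f : (1 < size phi)%N -> mu_minimal mu phi ->
  mu f = aug mu phi (mu phi) f.
Proof.
move=> s1 min; move: f; apply: (expansion_ind s1) => [|q r sr IH].
  by rewrite aug0 vfun0.
by rewrite mu_minimal_divp // aug_expand ?vfun0 // vfunM IH addrC minC.
Qed.

End Nodes.

(** * Augmented valuations *)

Section Augmentation.
Variables (K : fieldType) (G L : ordAbGroupType).
Variables (v : valuation K G) (iota : G -> L).
Variables (mu nu : node v iota) (phi : {poly K}).
Hypothesis sep : separates mu nu phi.
Implicit Types (f g a b q r : {poly K}) (gamma : wtop L).

Let s1 : (1 < size phi)%N := separates_size sep.
Let phi0 : phi != 0 := separates_neq0 sep.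

(** Below the degree of [phi], reducing a product modulo [phi] does not change
    its value. If the remainder had a larger value than the multiple of [phi],
    then [nu] would take a larger value than [mu] on the product. *)
Lemma separates_mul_modp a b : (size a < size phi)%N -> (size b < size phi)%N ->
  mu ((a * b) %% phi) = mu a + mu b /\
  mu a + mu b <= mu ((a * b) %/ phi) + mu phi.
Proof.
move=> sa sb; case: (sep) => _ le lt agree.
have [->|a0] := eqVneq a 0.
  by rewrite mul0r mod0p div0p !vfun0.
have [->|b0] := eqVneq b 0.
  by rewrite mulr0 mod0p div0p !vfun0 addInfty.
rewrite -!vfunM; set f := a * b.
have ef : mu f = nu f by rewrite !vfunM !agree.
have ff : mu f != Infty.
  by rewrite vfunM wtop_add_eqInfty negb_or !(separates_fin sep).
have er : mu (f %% phi) = nu (f %% phi) by rewrite agree // ltn_modp.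
have lerq : mu (f %% phi) <= mu (f %/ phi * phi).
  rewrite leNgt; apply/negP => ltq.
  have eq : mu f = mu (f %/ phi * phi) by rewrite {1}(divp_eq f phi) vfunD_lt.
  have : mu f < nu f.
    rewrite {2}(divp_eq f phi); apply: vfun_ltD; last by rewrite -er eq.
    by rewrite eq; apply: node_lt_mul => //; rewrite -eq.
  by rewrite -ef ltxx.
suff erf : mu (f %% phi) = mu f by rewrite -{2}erf.
have [q0|q0] := eqVneq (mu (f %/ phi * phi)) Infty.
  by rewrite {2}(divp_eq f phi) vfun_addInfty.
rewrite ef {2}(divp_eq f phi) addrC vfunD_lt // -er.
by apply: le_lt_trans lerq _; apply: node_lt_mul.
Qed.

Lemma size_divp_mul a b : (size a < size phi)%N -> (size b < size phi)%N ->
  (size ((a * b) %/ phi)%R < size phi)%N.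
Proof.
move=> sa sb; rewrite size_divp //.
move: (size_polyMleq a b) s1 sa sb; rewrite -!subn1.
by move: (size (a * b)%R) (size a) (size b) (size phi) => x y z t; lia.
Qed.

Section AugProduct.
Variable gamma : wtop L.
Hypothesis lt_gamma : mu phi < gamma.
Local Notation w := (aug mu phi gamma).

Let mu0 : mu 0 = Infty := vfun0 mu.

Lemma aug_mul_small a b : (size a < size phi)%N -> (size b < size phi)%N ->
  w (a * b) = mu a + mu b.
Proof.
move=> sa sb; have [er leq] := separates_mul_modp sa sb.
rewrite augE // er (aug_small _ _ _ (size_divp_mul sa sb)) //.
rewrite (min_idPl _) //; apply: le_trans leq _.
by rewrite addrC wtop_le_add // ltW.
Qed.

Lemma augD_min f g : Num.min (w f) (w g) <= w (f + g).
Proof.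
move: f g; apply: (expansion_ind s1) => [|q r sr IH] g.
  by rewrite add0r aug0 (min_idPr _) ?leInfty.
rewrite {2}(divp_eq g phi) addrACA -mulrDl [X in _ <= X]aug_expand //; last first.
  by apply: leq_ltn_trans (size_polyD _ _) _; rewrite gtn_max sr ltn_modp.
rewrite (augE _ s1 mu0 g) aug_expand // le_min; apply/andP; split.
  by apply: vfun_leD; rewrite !ge_min lexx ?orbT.
apply: le_trans (wtop_le_add (lexx gamma) (IH _)).
by rewrite wtop_add_min le_min !ge_min !lexx !orbT.
Qed.

Lemma augN f : w (- f) = w f.
Proof.
move: f; apply: (expansion_ind s1) => [|q r sr IH]; first by rewrite oppr0.
by rewrite opprD -mulNr !aug_expand ?size_polyN // vfunN IH.
Qed.

Lemma augD_lt f g : w f < w g -> w (f + g) = w f.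
Proof.
move=> h; apply/le_anti/andP; split; last first.
  by apply: le_trans (augD_min f g); rewrite (min_idPl _) // ltW.
have := augD_min (f + g) (- g); rewrite addrK augN ge_min => /orP[//|].
by rewrite leNgt h.
Qed.

(** Both factors are written as [q * phi + r], and the induction is on the sum
    of their sizes. *)
Lemma augM_ge f g : w f + w g <= w (f * g).
Proof.
have [n] := ubnP (size f + size g); elim: n f g => // n IH f g sfg.
have [->|f0] := eqVneq f 0; first by rewrite mul0r aug0.
have [->|g0] := eqVneq g 0; first by rewrite mulr0 aug0 addInfty.
set q := f %/ phi; set r := f %% phi; set q' := g %/ phi; set r' := g %% phi.
have sr : (size r < size phi)%N by rewrite ltn_modp.
have sr' : (size r' < size phi)%N by rewrite ltn_modp.
have sq : (size q < size f)%N by apply: size_divp_lt.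
have sq' : (size q' < size g)%N by apply: size_divp_lt.
have -> : f * g = (q * g) * phi + ((r * q') * phi + r * r').
  rewrite {1}(divp_eq f phi) -/q -/r mulrDl mulrAC; congr (_ + _).
  by rewrite {1}(divp_eq g phi) -/q' -/r' mulrDr mulrA.
have wf : w f = Num.min (mu r) (gamma + w q) by rewrite augE.
have wg : w g = Num.min (mu r') (gamma + w q') by rewrite augE.
have f1 : w f <= mu r by rewrite wf ge_min lexx.
have f2 : w f <= gamma + w q by rewrite wf ge_min lexx orbT.
have g1 : w g <= mu r' by rewrite wg ge_min lexx.
have g2 : w g <= gamma + w q' by rewrite wg ge_min lexx orbT.
apply: le_trans (augD_min _ _); rewrite le_min; apply/andP; split.
  rewrite aug_mul_phi //; apply: (@le_trans _ _ (gamma + (w q + w g))).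
    by rewrite addrA wtop_le_add.
  by apply: wtop_le_add => //; apply: IH; rewrite -ltnS; apply: leq_trans sfg; rewrite ltnS ltn_add2r.
apply: le_trans (augD_min _ _); rewrite le_min; apply/andP; split.
  rewrite aug_mul_phi //; apply: (@le_trans _ _ (gamma + (w r + w q'))).
    by rewrite addrCA; apply: wtop_le_add; rewrite ?(aug_small _ _ _ sr).
  apply: wtop_le_add => //; apply: IH; rewrite -ltnS; apply: leq_trans sfg.
  by rewrite ltnS -addnS leq_add // leq_modp.
by rewrite aug_mul_small // wtop_le_add.
Qed.

Lemma augM f g : w (f * g) = w f + w g.
Proof.
have [n] := ubnP (size f + size g); elim: n f g => // n IH f g sfg.
have [->|f0] := eqVneq f 0; first by rewrite mul0r aug0.
have [->|g0] := eqVneq g 0; first by rewrite mulr0 aug0 addInfty.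
have [wfg|] := eqVneq (w f + w g) Infty.
  by apply/eqP; rewrite wfg -Inftyle -wfg augM_ge.
rewrite wtop_add_eqInfty negb_or => /andP[wf0 wg0].
(* If the value of a factor is not attained at its constant coefficient, then
   the product is dominated by a multiple of [phi], and induction applies. *)
have high f1 g1 : (size f1 + size g1 < n.+1)%N -> f1 != 0 -> w g1 != Infty ->
    gamma + w (f1 %/ phi) < mu (f1 %% phi) -> w (f1 * g1) = w f1 + w g1.
  move=> s f10 wg1 lt; rewrite {1}(divp_eq f1 phi) mulrDl mulrAC.
  have e : w (f1 %/ phi * g1 * phi) = w f1 + w g1.
    rewrite aug_mul_phi // IH; last first.
      by rewrite -ltnS; apply: leq_trans s; rewrite ltnS ltn_add2r size_divp_lt.
    by rewrite addrA (augE _ s1 mu0 f1) [Num.min _ _](min_idPr _) // ltW.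
  rewrite augD_lt e //; apply: lt_le_trans (augM_ge _ _).
  rewrite (augE _ s1 mu0 f1) [Num.min _ _](min_idPr _) ?ltW //.
  have -> : w (f1 %% phi) = mu (f1 %% phi) by apply: aug_small; rewrite ?ltn_modp.
  by apply: wtop_lt_add => //; left.
have [le1|] := leP (mu (f %% phi)) (gamma + w (f %/ phi)); last exact: high.
have [le2|] := leP (mu (g %% phi)) (gamma + w (g %/ phi)); last first.
  by rewrite mulrC [RHS]addrC; apply: high; rewrite // addnC.
(* Otherwise the constant coefficient of the product has the required value. *)
apply/le_anti; rewrite augM_ge andbT.
rewrite (augE _ s1 mu0 (f * g)) (augE _ s1 mu0 f) (augE _ s1 mu0 g).
rewrite (min_idPl le1) (min_idPl le2) ge_min.
have sr : (size (f %% phi)%R < size phi)%N by rewrite ltn_modp.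
have sr' : (size (g %% phi)%R < size phi)%N by rewrite ltn_modp.
have [<- _] := separates_mul_modp sr sr'.
have -> : (f %% phi * (g %% phi)) %% phi = (f * g) %% phi.
  by rewrite modp_mul mulrC modp_mul mulrC.
by rewrite lexx.
Qed.

Lemma exists_aug_node : exists w : node v iota, forall f, w f = aug mu phi gamma f.
Proof.
have w1 : w 1 = 0 by rewrite aug_small ?size_poly1 // vfun1.
have w0 : w 0 = Infty by exact: aug0.
pose W := @Valuation {poly K} L w w1 w0 augM augD_min.
have We (c : K) : W c%:P = wtop_map iota (v c).
  have sc : (size c%:P < size phi)%N := leq_ltn_trans (size_polyC_leq1 c) s1.
  by rewrite /W /= aug_small ?node_ext ?vfun0.
by exists (@Node K G L v iota W We).
Qed.

End AugProduct.

(** Modulo [phi], a nonzero polynomial of smaller degree has an inverse, of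
    opposite value. Indeed [phi] has no proper factor, since [mu] and [nu] would
    agree on both factors. *)
Lemma separates_inverse a : a != 0 -> (size a < size phi)%N ->
  exists u q : {poly K}, [/\ (size u < size phi)%N, u * a = q * phi + 1,
    mu u + mu a = 0 & Fin 0 <= mu q + mu phi].
Proof.
move=> a0 sa; case: (sep) => mphi le lt agree.
have cop : coprimep a phi.
  rewrite /coprimep; set g := gcdp a phi.
  have g0 : g != 0 by rewrite gcdp_eq0 negb_and a0.
  have sg : (size g < size phi)%N.
    by apply: leq_ltn_trans sa; apply: dvdp_leq => //; apply: dvdp_gcdl.
  have eg : phi = (phi %/ g) * g by rewrite divpK // dvdp_gcdr.
  have h0 : phi %/ g != 0 by apply: contraNneq phi0 => h; rewrite eg h mul0r.
  rewrite eqn_leq size_poly_gt0 g0 andbT leqNgt; apply/negP => g1.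
  move: lt; rewrite eg !vfunM !agree ?ltxx //; exact: size_divp_lt.
have [[x y] /= exy] := Bezout_eq1_coprimepP _ _ cop.
have su : (size (x %% phi)%R < size phi)%N by rewrite ltn_modp.
have e : x %% phi * a = (- (y + x %/ phi * a)) * phi + 1.
  move: (divp_eq x phi); move: (x %/ phi) (x %% phi) => s t ex.
  by rewrite -exy ex; ring.
exists (x %% phi), (- (y + x %/ phi * a)); split=> //.
  have [<- _] := separates_mul_modp su sa.
  by rewrite e modp_addl_mul_small ?size_poly1 // vfun1.
have [e1 e2] := separates_mul_modp su sa; move: e2; rewrite -e1 e.
by rewrite modp_addl_mul_small ?divp_addl_mul_small ?size_poly1 // vfun1.
Qed.

Section AugKP.
Variables (gamma : wtop L) (w : node v iota).
Hypotheses (lt_gamma : mu phi < gamma).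
Hypothesis we : forall f, w f = aug mu phi gamma f.

Lemma aug_node_small r : (size r < size phi)%N -> w r = mu r.
Proof. by move=> sr; rewrite we aug_small ?vfun0. Qed.

Lemma aug_node_phi : w phi = gamma.
Proof. by rewrite we aug_phi ?vfun0 ?vfun1. Qed.

Lemma aug_node_le (w' : node v iota) :
  (forall r, (size r < size phi)%N -> mu r <= w' r) -> gamma <= w' phi ->
  node_le w w'.
Proof. by move=> h1 h2 f; rewrite we aug_le ?vfun0. Qed.

(** The initial terms of polynomials of degree smaller than that of [phi] are
    units, so that none of them is a key polynomial. *)
Lemma aug_KP_size psi : KP w psi -> (size phi <= size psi)%N.
Proof.
move=> [mpsi _ [_ [[_ /negP not1 _] _]]]; rewrite leqNgt; apply/negP => spsi.
have psi0 := monic_neq0 mpsi.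
have [u [q [su eq eu leq]]] := separates_inverse psi0 spsi.
apply: not1; apply/asboolP.
have /wtop_finP[b eb] : w psi != Infty.
  by rewrite aug_node_small // (separates_fin sep).
have -> : 1 = initial w 1.
  by rewrite (initialE (vfun1 w)) pi_graded_one; congr (\pi_(graded w) _); apply/val_inj.
apply/(mu_dividesP (vfun1 w) eb); exists u.
rewrite eq opprD addrCA subrr addr0 vfunN we aug_mul_phi ?vfun0 //.
have [->|q0] := eqVneq q 0; first by rewrite aug0 addInfty.
apply: le_lt_trans leq _; rewrite addrC.
have sq : (size q < size phi)%N.
  rewrite -[q](@divp_addl_mul_small _ phi q 1) ?size_poly1 // -eq.
  exact: size_divp_mul.
rewrite aug_small ?vfun0 //; apply: wtop_lt_add => //.
by left; apply: separates_fin sep _ _.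
Qed.

(** The polynomial [phi] separates the node with finite [gamma] from the one
    obtained for [gamma] infinite. *)
Lemma aug_min_KP : gamma != Infty -> min_KP w phi.
Proof.
move=> gfin; have lt_infty : mu phi < Infty by apply: lt_le_trans lt_gamma (leInfty _).
have [w' w'e] := exists_aug_node lt_infty.
split; last first.
  by move=> psi /aug_KP_size spsi; rewrite /deg -!subn1 leq_sub2r.
apply: (@separates_KP _ _ _ _ _ w w'); split.
- by case: sep.
- apply: aug_node_le => [r sr|]; last by rewrite w'e aug_phi ?vfun0 ?vfun1 ?leInfty.
  by rewrite w'e aug_small ?vfun0.
- by rewrite aug_node_phi w'e aug_phi ?vfun0 ?vfun1 // ltInfty.
- by move=> f sf; rewrite aug_node_small // w'e aug_small ?vfun0.
Qed.

End AugKP.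

End Augmentation.

(** * Well-ordered cofinal subsets *)

Section WellOrderedCofinal.
Variables (d : Order.disp_t) (T : orderType d).

(** The elements of [D] larger than all the elements of [D] that precede them in
    some well-ordering of the carrier form a well-ordered cofinal subset. *)
Lemma exists_wo_cofinal (D : set T) : exists W : set T,
  [/\ W `<=` D, forall x, D x -> exists2 y, W y & (x <= y)%O
    & forall S : set T, S `<=` W -> S !=set0 ->
        exists2 x, S x & forall y, S y -> (x <= y)%O].
Proof.
have [R woR] := well_ordering_principle T.
have least (S : set T) : S !=set0 -> exists2 x, S x & forall y, S y -> R x y.
  move=> [x Sx].
  have [|z [[/asboolP Sz zmin] _]] := woR [pred y | `[< S y >]].
    by exists x; apply/asboolP.
  by exists z => // y Sy; apply: zmin; apply/asboolP.
pose W := [set x | D x /\ forall y, D y -> R y x -> y != x -> (y < x)%O].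
exists W; split=> [x []//|x Dx|S SW /least[x Sx xmin]].
  have [|y [Dy xy] ymin] := least [set y | D y /\ (x <= y)%O]; first by exists x.
  (* A well-ordering in the present sense is reflexive and antisymmetric, as is
     seen on singletons and pairs. *)
  have antiR z : R z y -> R y z -> z = y.
    move=> zy yz; have [|u [_ uniq]] := woR (pred2 y z).
      by exists y; rewrite inE eqxx.
    have refl t : R t t.
      have [|s [[/eqP -> smin] _]] := woR (pred1 t); first by exists t; rewrite inE.
      by apply: smin; rewrite inE.
    rewrite -(uniq y) ?(uniq z) //; split; rewrite ?inE ?eqxx ?orbT //;
      by move=> t; rewrite inE => /orP[] /eqP ->.
  exists y => //; split=> // z Dz zy nzy; apply: lt_le_trans xy.
  rewrite ltNge; apply: contraNN nzy => xz; apply/eqP/antiR => //.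
  by apply: ymin.
exists x => // y Sy; have [->//|nxy] := eqVneq x y.
have [Dx _] := SW _ Sx; have [_ h] := SW _ Sy.
by apply/ltW/h => //; apply: xmin.
Qed.

(** The elements of a set, with the order of the ambient type. *)
Definition sub_order (W : set T) := {x : T | `[< W x >]}.

HB.instance Definition _ W := SubType.on (sub_order W).
HB.instance Definition _ W := Choice.on (sub_order W).
HB.instance Definition _ W := [SubChoice_isSubOrder of sub_order W by <: with d].

End WellOrderedCofinal.

(** * Key polynomials of a continuous family *)

Section MonicLemmas.
Variable K : fieldType.

Lemma size_monic_sub (p q : {poly K}) : p \is monic -> q \is monic ->
  size p = size q -> (size (p - q)%R < size p)%N.
Proof.
move=> mp mq spq; have p0 : (0 < size p)%N by rewrite size_poly_gt0 monic_neq0.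
rewrite -[ltnRHS](prednK p0) ltnS; apply/leq_sizeP => j; rewrite coefB.
rewrite leq_eqVlt => /orP[/eqP <-|lt]; last first.
  by rewrite !nth_default ?subrr // -?spq -(prednK p0).
have := monicP mp; have := monicP mq; rewrite !lead_coefE -spq => -> ->.
by rewrite subrr.
Qed.

End MonicLemmas.

Section KeyPolynomials.
Variables (K : fieldType) (G L : ordAbGroupType).
Variables (v : valuation K G) (iota : G -> L).
Implicit Types (mu : node v iota) (phi f : {poly K}).

Lemma KP_size mu phi : KP mu phi -> (1 < size phi)%N.
Proof.
move=> [mphi _ [_ [[_ /negP not1 _] _]]]; rewrite ltnNge; apply/negP => s1.
apply: not1; apply/asboolP; exists 1; rewrite mul1r.
move: mphi; rewrite (size1_polyC s1) monicE lead_coefC => /eqP ->.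
by rewrite (initialE (vfun1 mu)) pi_graded_one; congr (\pi_(graded mu) _); apply/val_inj.
Qed.

Lemma xget_min_KP mu : KP mu !=set0 -> min_KP mu (xget 0 (min_KP mu)).
Proof.
move=> [phi KPphi]; apply: xgetPex.
pose P n := `[< exists2 psi, KP mu psi & deg psi = n >].
have exP : exists n, P n by exists (deg phi); apply/asboolP; exists phi.
case: (ex_minnP exP) => n /asboolP[psi KPpsi <-] nmin; exists psi; split=> // chi KPchi.
by apply: nmin; apply/asboolP; exists chi.
Qed.

Lemma min_KP_deg mu phi : min_KP mu phi -> deg_node mu = deg phi.
Proof.
move=> [KPphi phimin]; have [|K2 min2] := @xget_min_KP mu; first by exists phi.
by apply/eqP; rewrite eqn_leq min2 // phimin.
Qed.

Lemma monic_size_deg phi : phi \is monic -> size phi = (deg phi).+1.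
Proof. by move=> /monic_neq0; rewrite -size_poly_gt0 /deg; case: (size phi). Qed.

(** Among the monic polynomials of its degree, a minimal polynomial has the
    largest value. *)
Lemma minimal_monic_le mu phi f : mu_minimal mu phi -> phi \is monic ->
  f \is monic -> size f = size phi -> mu f <= mu phi.
Proof.
move=> min mphi mf sf; have sub := size_monic_sub mf mphi sf.
rewrite -{1}(subrK phi f) addrC -[phi in phi + _]mul1r.
by rewrite mu_minimal_divp // -?sf // mul1r ge_min lexx.
Qed.

Lemma min_KP_sv mu phi : min_KP mu phi -> sv mu = mu phi.
Proof.
move=> minphi; have [KPphi phimin] := minphi.
have [|K2 min2] := @xget_min_KP mu; first by exists phi.
have [m1 m2 _] := KPphi; have [m3 m4 _] := K2.
have sz : size phi = size (xget 0 (min_KP mu)).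
  by rewrite !monic_size_deg //; congr S; apply/eqP; rewrite eqn_leq min2 // phimin.
by apply/le_anti/andP; split; apply: minimal_monic_le.
Qed.

End KeyPolynomials.

Section Family.
Variables (K : fieldType) (G L : ordAbGroupType).
Variables (v : valuation K G) (iota : G -> L).
Variables (d : Order.disp_t) (A : orderType d) (rho : A -> node v iota).
Hypothesis rho_family : inner_family rho.
Variables (m : nat) (i0 : A).
Hypothesis rho_deg : forall i, (i0 <= i)%O -> deg_node (rho i) = m.
Implicit Types (f q r phi : {poly K}) (i j k : A) (x : wtop L).

(** The minimal key polynomial of [rho i] off which its singular value is
    read. *)
Definition key i : {poly K} := xget 0 (min_KP (rho i)).

Lemma family_le i j : (i <= j)%O -> node_le (rho i) (rho j).
Proof. by case: rho_family => _ h _; apply: (proj1 (h i j)). Qed.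

Lemma family_lt i j : (i < j)%O -> exists f, rho i f < rho j f.
Proof.
move=> ij; case: rho_family => _ h _; apply: contrapT => no.
move: ij; rewrite ltNge => /negP; apply; apply: (proj2 (h j i)) => f.
by rewrite leNgt; apply/negP => lt; apply: no; exists f.
Qed.

Lemma family_next i : exists j, (i < j)%O.
Proof. by case: rho_family => _ _. Qed.

Lemma keyP i : min_KP (rho i) (key i).
Proof.
apply: xget_min_KP; have [j ij] := family_next i; have [f lt] := family_lt ij.
have [phi sep] := exists_separates (family_le (ltW ij)) lt.
by exists phi; apply: separates_KP sep.
Qed.

Lemma key_monic i : key i \is monic.
Proof. by case: (keyP i) => -[]. Qed.

Lemma key_minimal i : mu_minimal (rho i) (key i).
Proof. by case: (keyP i) => -[]. Qed.

Lemma key_size i : (i0 <= i)%O -> size (key i) = m.+1.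
Proof. by move=> /rho_deg <-; rewrite monic_size_deg ?key_monic. Qed.

Lemma family_KP_size i phi : (i0 <= i)%O -> KP (rho i) phi -> (m < size phi)%N.
Proof.
move=> ii KPphi; have [_ min] := keyP i; have := min _ KPphi.
have [mphi _ _] := KPphi.
by rewrite (monic_size_deg mphi) ltnS; congr (_ <= _)%N; rewrite -(rho_deg ii).
Qed.

Lemma family_agree i j f : (i0 <= i)%O -> (i <= j)%O -> (size f <= m)%N ->
  rho i f = rho j f.
Proof.
move=> ii; rewrite le_eqVlt => /orP[/eqP -> //|ij] sf.
apply/eqP; rewrite eq_le (family_le (ltW ij)) leNgt; apply/negP => lt.
have [phi sep] := exists_separates (family_le (ltW ij)) lt.
have := family_KP_size ii (separates_KP sep); rewrite ltnNge => /negP; apply.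
apply: leq_trans sf; rewrite leqNgt; apply/negP => sf.
by move: lt; case: sep => _ _ _ ->; rewrite ?ltxx.
Qed.

Lemma family_separates i j phi : (i0 <= i)%O -> (i <= j)%O -> phi \is monic ->
  size phi = m.+1 -> rho i phi < rho j phi -> separates (rho i) (rho j) phi.
Proof.
move=> ii ij mphi sphi lt; split=> //; first exact: family_le.
by move=> f; rewrite sphi ltnS => sf; apply: family_agree.
Qed.

(** An equality would give [rho j <= rho i], by the formula for [rho j] on
    expansions with respect to its key polynomial. *)
Lemma key_lt i j : (i0 <= i)%O -> (i < j)%O -> rho i (key j) < rho j (key j).
Proof.
move=> ii ij; have jj := le_trans ii (ltW ij).
rewrite lt_def family_le ?ltW // andbT; apply/eqP => e.
have [f] := family_lt ij; apply/negP; rewrite -leNgt.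
have s1 := KP_size (proj1 (keyP j)).
rewrite (mu_minimal_aug f s1 (@key_minimal j)); apply: aug_le; rewrite ?vfun0 //.
  by move=> r; rewrite key_size // ltnS => sr; rewrite (family_agree ii (ltW ij)).
by rewrite e.
Qed.

(** The singular value is the largest value of a monic polynomial of degree
    [m]; it is attained by those whose value increases later on. *)
Lemma sv_ge i phi : (i0 <= i)%O -> phi \is monic -> size phi = m.+1 ->
  rho i phi <= rho i (key i).
Proof.
move=> ii mphi sphi; apply: minimal_monic_le; rewrite ?key_monic ?key_size //.
exact: key_minimal.
Qed.

Lemma sv_eq i j phi : (i0 <= i)%O -> (i <= j)%O -> phi \is monic ->
  size phi = m.+1 -> rho i phi < rho j phi -> rho i phi = rho i (key i).
Proof.
move=> ii ij mphi sphi lt; apply/le_anti; rewrite sv_ge //=.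
apply: minimal_monic_le; rewrite ?key_monic ?key_size //.
exact: separates_minimal (family_separates ii ij mphi sphi lt).
Qed.

Lemma sv_lt i j : (i0 <= i)%O -> (i < j)%O -> rho i (key i) < rho j (key j).
Proof.
move=> ii ij; have lt := key_lt ii ij.
by rewrite -(sv_eq ii (ltW ij) (key_monic j) (key_size (le_trans ii (ltW ij))) lt).
Qed.

(** * Augmentations with stable values *)

Hypothesis rho_stable : forall f, (size f <= m.+1)%N -> stable rho f.

Let mu0 := rho i0.

(** [stable_value phi x]: the stable value of [phi] is [x]. *)
Definition stable_value phi x : Prop :=
  exists2 i, (i0 <= i)%O & forall j, (i <= j)%O -> rho j phi = x.

(** [good phi x]: the polynomial [phi] is monic of degree [m], and its stable
    value [x] exceeds the singular value of [rho i0]. *)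
Definition good phi x : Prop :=
  [/\ phi \is monic, size phi = m.+1, stable_value phi x & mu0 (key i0) < x].

Lemma exists_stable_value phi : (size phi <= m.+1)%N -> exists x, stable_value phi x.
Proof.
move=> /rho_stable[i hi]; exists (rho i phi), (Order.max i0 i); rewrite ?le_max ?lexx //.
move=> j; rewrite ge_max => /andP[_]; rewrite le_eqVlt => /orP[/eqP -> //|ij].
by rewrite -hi.
Qed.

(** The stable value of a good polynomial is smaller than the singular values
    of the family from some index on. *)
Lemma good_bound phi x : good phi x -> exists2 i, (i0 < i)%O &
  forall j, (i <= j)%O -> rho j phi = x /\ x < rho j (key j).
Proof.
move=> [mphi sphi [i ii hi] _]; have [k ik] := family_next i.
exists k => [|j kj]; first exact: le_lt_trans ii ik.
have ij := lt_le_trans ik kj; split; first exact/hi/ltW.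
apply: le_lt_trans (sv_lt ii ij).
by rewrite -(hi i (lexx i)) sv_ge.
Qed.

Lemma good_separates phi x i : good phi x -> (i0 <= i)%O ->
  rho i (key i) < x -> exists j, separates (rho i) (rho j) phi.
Proof.
move=> gphi ii ltx; have [k _ hk] := good_bound gphi.
case: gphi => mphi sphi _ _; exists (Order.max i k).
have ij : (i <= Order.max i k)%O by rewrite le_max lexx.
apply: (family_separates ii ij) => //.
have [|-> _] := hk (Order.max i k); first by rewrite le_max lexx orbT.
by apply: le_lt_trans ltx; apply: sv_ge.
Qed.

Lemma good_fin phi x : good phi x -> x != Infty.
Proof.
move=> /good_bound[i _ /(_ i (lexx i))[_]]; apply: contraTneq => ->.
by rewrite -leNgt leInfty.
Qed.

(** Stable values of good polynomials are cofinal in the singular values of the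
    family, as shown by the key polynomials themselves. *)
Lemma good_above i : (i0 <= i)%O -> exists phi x, good phi x /\ rho i (key i) < x.
Proof.
move=> ii; have [j ij] := family_next i; have jj := le_trans ii (ltW ij).
have [x [k kk hk]] := exists_stable_value (eq_leq (key_size jj)).
have lt : rho i (key i) < x.
  apply: lt_le_trans (sv_lt ii ij) _.
  rewrite -(hk (Order.max j k)) ?le_max ?lexx ?orbT //.
  by apply: family_le; rewrite le_max lexx.
exists (key j), x; split; last exact: lt.
split; [exact: key_monic|exact: key_size|by exists k|].
apply: le_lt_trans lt; move: ii; rewrite le_eqVlt => /orP[/eqP <- //|ii].
exact/ltW/sv_lt.
Qed.

Section AugNode.
Variables (phi : {poly K}) (x : wtop L) (w : node v iota).
Hypotheses (gphi : good phi x) (we : forall f, w f = aug mu0 phi x f).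

Let sphi : size phi = m.+1. Proof. by case: gphi. Qed.
Let mphi : phi \is monic. Proof. by case: gphi. Qed.

Let sep : exists j, separates mu0 (rho j) phi.
Proof. by apply: (good_separates gphi) => //; case: gphi. Qed.

Let lt_x : mu0 phi < x.
Proof. by case: gphi => _ _ _; apply: le_lt_trans; apply: sv_ge. Qed.

Lemma aug_good_small r : (size r <= m)%N -> w r = mu0 r.
Proof. by case: sep => j s sr; apply: (aug_node_small s we); rewrite sphi. Qed.

Lemma aug_good_phi : w phi = x.
Proof. by case: sep => j s; apply: (aug_node_phi s we). Qed.

Lemma aug_good_le (w' : node v iota) :
  (forall r, (size r <= m)%N -> mu0 r <= w' r) -> x <= w' phi -> node_le w w'.
Proof.
by case: sep => j s h; apply: (aug_node_le s we) => r; rewrite sphi ltnS; apply: h.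
Qed.

Lemma aug_good_min_KP : min_KP w phi.
Proof. by case: sep => j s; apply: (aug_min_KP s lt_x we); apply: good_fin gphi. Qed.

Lemma aug_good_deg : deg_node w = m.
Proof. by rewrite (min_KP_deg aug_good_min_KP) /deg sphi. Qed.

Lemma aug_good_sv : sv w = x.
Proof. by rewrite (min_KP_sv aug_good_min_KP) aug_good_phi. Qed.

Lemma aug_good_le_family : exists j, node_le w (rho j).
Proof.
have [j ii hj] := good_bound gphi; exists j; apply: aug_good_le => [r sr|].
  by rewrite -(family_agree (lexx i0) (ltW ii) sr).
by have [-> _] := hj j (lexx j).
Qed.

Lemma family_le_aug_good i : (i0 <= i)%O -> rho i (key i) < x -> node_le (rho i) w.
Proof.
move=> ii ltx f; have s1 := KP_size (proj1 (keyP i)).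
have small r : (size r <= m)%N -> w r = rho i r.
  by move=> sr; rewrite aug_good_small // (family_agree (lexx i0) ii).
have [j s] := good_separates gphi ii ltx.
rewrite (mu_minimal_aug f s1 (@key_minimal i)); apply: aug_le; rewrite ?vfun0 //.
  by move=> r; rewrite key_size // ltnS => /small ->.
have sub : (size (key i - phi)%R <= m)%N.
  by rewrite -ltnS -(key_size ii) size_monic_sub ?key_monic // sphi key_size.
rewrite -(subrK phi (key i)); apply: vfun_leD; last first.
  by rewrite subrK aug_good_phi ltW.
rewrite subrK small //; apply: vfun_leB => //.
apply: minimal_monic_le; rewrite ?key_monic ?key_size //.
exact: separates_minimal s.
Qed.

(** The values of nonzero polynomials of degree less than [m]. They are the same
    for the nodes of the family from [rho i0] on and for their augmentations
    considered here, and they form a group, by multiplication and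
    inversion modulo [phi]. *)
Definition small_value (a : L) : Prop :=
  exists f, [/\ f != 0, (size f <= m)%N & mu0 f = Fin a].

Lemma small_valueD a b : small_value a -> small_value b -> small_value (a + b).
Proof.
move=> [f [f0 sf ef]] [g [g0 sg eg]]; have [j s] := sep.
rewrite -ltnS -sphi in sf; rewrite -ltnS -sphi in sg.
have [e _] := separates_mul_modp s sf sg.
exists ((f * g) %% phi); split.
- by apply/eqP => h; move: e; rewrite h vfun0 ef eg.
- by rewrite -ltnS -sphi ltn_modp (separates_neq0 s).
- by rewrite e ef eg.
Qed.

Lemma small_valueN a : small_value a -> small_value (- a).
Proof.
move=> [f [f0 sf ef]]; have [j s] := sep.
have sf' : (size f < size phi)%N by rewrite sphi ltnS.
have [u [q [su _ eu _]]] := separates_inverse s f0 sf'.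
exists u; split.
- by apply: contra_eq_neq eu => ->; rewrite vfun0.
- by rewrite -ltnS -sphi.
- move: eu; rewrite ef; case: (mu0 u) => // b [/eqP]; rewrite addr_eq0 => /eqP ->.
  by [].
Qed.

(** The stable value of [phi] is attained by [key j - phi] for [j] large. *)
Lemma small_value_stable : exists2 a, small_value a & x = Fin a.
Proof.
have [j ii hj] := good_bound gphi; have [e lt] := hj j (lexx j).
have jj := ltW ii.
have /wtop_finP[a ea] := good_fin gphi; exists a => //.
have er : rho j (key j - phi) = Fin a by rewrite vfunB_gt e ?ea // -ea.
have sub : (size (key j - phi)%R <= m)%N.
  by rewrite -ltnS -(key_size jj) size_monic_sub ?key_monic // sphi key_size.
exists (key j - phi); split=> //.
  by apply/eqP => h; move: er; rewrite h vfun0.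
by rewrite /mu0 (family_agree (lexx i0) jj).
Qed.

(** The value [Infty] is kept as an alternative because it is that of [0]. *)
Lemma aug_good_value f : w f = Infty \/ exists2 a, small_value a & w f = Fin a.
Proof.
have [j s] := sep; have s1 := separates_size s.
move: f; apply: (expansion_ind s1) => [|q r sr IH]; first by left; rewrite vfun0.
rewrite we aug_expand ?vfun0 // -we; case: leP => _.
  have [->|r0] := eqVneq r 0; first by left; rewrite vfun0.
  have /wtop_finP[a ea] := separates_fin s r0 sr.
  by right; exists a => //; exists r; rewrite -ltnS -sphi.
case: IH => [->|[b Hb ->]]; first by left; rewrite addInfty.
have [c Hc ->] := small_value_stable.
by right; exists (c + b) => //; apply: small_valueD.
Qed.

Lemma aug_good_value_group a : value_group w a <-> small_value a.
Proof.
split=> [[f [g [b [c [ef eg ->]]]]]|[f [f0 sf ef]]]; last first.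
  by apply: (@mem_value_group _ _ w f); rewrite aug_good_small.
apply: small_valueD; last apply: small_valueN.
  by have [|[b' hb]] := aug_good_value f; rewrite ef // => -[->].
by have [|[c' hc]] := aug_good_value g; rewrite eg // => -[->].
Qed.

Lemma aug_good_value_group0 a : value_group0 w a <-> small_value a.
Proof.
have [j s] := sep; have := separates_size s; rewrite sphi ltnS => m0.
rewrite /value_group0 /= aug_good_deg; split=> -[f [f0 sf ef]]; exists f.
  have sf' : (size f <= m)%N.
    by move: sf f0; rewrite -size_poly_gt0 /deg; case: (size f).
  by split=> //; rewrite -aug_good_small.
split=> //; last by rewrite aug_good_small.
by move: sf f0; rewrite -size_poly_gt0 /deg; case: (size f).
Qed.

Lemma aug_good_ramification : ramification_index_is w 1.
Proof.
have [j s] := sep.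
have e0 : value_group0 w = [set a | small_value a].
  by apply/seteqP; split=> a /aug_good_value_group0.
have e1 : value_group w = [set a | small_value a].
  by apply/seteqP; split=> a /aug_good_value_group.
rewrite /ramification_index_is e0 e1.
suff -> : cosets [set a | small_value a] [set a | small_value a] =
    [set [set a | small_value a]] by exact: card_set1.
have coset a : small_value a ->
    [set a + b | b in [set a | small_value a]] = [set a | small_value a].
  move=> ha; apply/seteqP; split=> [_ [b hb <-]|b hb] /=; first exact: small_valueD.
  exists (- a + b); last by rewrite addNKr.
  by apply: small_valueD => //; apply: small_valueN.
apply/seteqP; split=> [_ [a ha <-] /=|_ ->]; first exact: coset.
have h0 : small_value 0 by apply/aug_good_value_group; apply: mem_value_group0.
by exists 0 => //; apply: coset.
Qed.

End AugNode.

Section TwoAugNodes.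
Variables (phi phi' : {poly K}) (x x' : wtop L) (w w' : node v iota).
Hypotheses (gphi : good phi x) (we : forall f, w f = aug mu0 phi x f).
Hypotheses (gphi' : good phi' x') (we' : forall f, w' f = aug mu0 phi' x' f).
Hypothesis lt_xx' : x < x'.

Lemma aug_good_sub_size : (size (phi' - phi)%R <= m)%N.
Proof.
case: gphi gphi' => mphi sphi _ _ [mphi' sphi' _ _].
by rewrite -ltnS -sphi' size_monic_sub // sphi'.
Qed.

Lemma aug_good_sub : mu0 (phi' - phi) = x.
Proof.
have [i ii hi] := good_bound gphi; have [j jj hj] := good_bound gphi'.
have [|ek _] := hi (Order.max i j); first by rewrite le_max lexx.
have [|ek' _] := hj (Order.max i j); first by rewrite le_max lexx orbT.
have kk : (i0 <= Order.max i j)%O by rewrite le_max ltW.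
by rewrite /mu0 (family_agree (lexx i0) kk aug_good_sub_size) vfunB_gt ek ?ek'.
Qed.

Lemma aug_good_phi' : w phi' = x.
Proof.
have [[_ min _] _] := aug_good_min_KP gphi we; have ep := aug_good_phi gphi we.
have [mphi sphi _ _] := gphi; have [mphi' sphi' _ _] := gphi'.
apply/le_anti; rewrite -{1}ep minimal_monic_le ?sphi' //=.
rewrite -(subrK phi phi'); apply: vfun_leD; last by rewrite ep.
by rewrite (aug_good_small gphi we aug_good_sub_size) aug_good_sub.
Qed.

Lemma aug_good'_phi : w' phi = x.
Proof.
have ep := aug_good_phi gphi' we'.
have e : w' (phi' - phi) = x.
  by rewrite (aug_good_small gphi' we' aug_good_sub_size) aug_good_sub.
by rewrite -[phi](subKr phi') vfunB_gt e ?ep.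
Qed.

Lemma aug_good_mono : node_le w w'.
Proof.
apply: (aug_good_le gphi we) => [r sr|]; first by rewrite (aug_good_small gphi' we' sr).
by rewrite aug_good'_phi.
Qed.

Lemma aug_good_separates : separates w w' phi'.
Proof.
have [mphi' sphi' _ _] := gphi'; split; [by []|exact: aug_good_mono| |].
  by rewrite aug_good_phi' (aug_good_phi gphi' we').
move=> f; rewrite sphi' ltnS => sf.
by rewrite (aug_good_small gphi we sf) (aug_good_small gphi' we' sf).
Qed.

Lemma aug_good_inner : inner w.
Proof.
move=> /(_ _ aug_good_mono) e; have := aug_good_phi gphi' we'.
by rewrite e aug_good_phi' => ex; move: lt_xx'; rewrite ex ltxx.
Qed.

Lemma aug_good_not_equiv : ~ mu_equiv w phi phi'.
Proof.
have /wtop_finP[a ea] := good_fin gphi.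
have e1 := aug_good_phi gphi we; have e2 := aug_good_phi'.
rewrite ea in e1 e2; move=> /(initial_eqP e1 e2).
by rewrite vfun_subC (aug_good_small gphi we aug_good_sub_size) aug_good_sub ea ltxx.
Qed.

Lemma aug_good_augmentation : is_augmentation w' w phi' (sv w').
Proof.
rewrite (aug_good_sv gphi' we'); split.
- exact: separates_KP aug_good_separates.
- by rewrite aug_good_phi'.
move=> n a sa; have [_ sphi' _ lt'] := gphi'.
have [j s] := good_separates gphi' (lexx i0) lt'.
rewrite we' aug_bigmin ?vfun0 ?(separates_size s) //.
by apply: eq_bigr => i _; rewrite (aug_good_small gphi we) // -ltnS -sphi'.
Qed.

End TwoAugNodes.

End Family.

Section UnstableDegree.
Variables (K : fieldType) (G L : ordAbGroupType).
Variables (v : valuation K G) (iota : G -> L).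
Variables (d : Order.disp_t) (A : orderType d) (rho : A -> node v iota).

Lemma stableZ (c : K) f : c != 0 -> stable rho (c *: f) -> stable rho f.
Proof.
move=> c0 [i hi]; exists i => j ij; have := hi j ij.
rewrite -mul_polyC !vfunM (node_polyC (rho j) (rho i)).
have /wtop_finP[a ->] := node_polyC_fin (rho i) c0.
by move=> /(congr1 (fun x => Fin (- a) + x)); rewrite !wtop_addKr.
Qed.

Lemma stable_of_size (i : A) (f : {poly K}) :
  (Fin (stable_degree rho) < unstable_degree rho)%O ->
  (size f <= (stable_degree rho).+1)%N -> stable rho f.
Proof.
move=> hm sf; apply: contrapT => nf.
have f0 : f != 0 by apply/eqP => e; apply: nf; exists i => j _; rewrite e !vfun0.
have lc0 : (lead_coef f)^-1 != 0 by rewrite invr_eq0 lead_coef_eq0.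
pose g := (lead_coef f)^-1 *: f.
have mg : g \is monic by rewrite monicE lead_coefZ mulVf // lead_coef_eq0.
have ng : ~ stable rho g by move=> /(stableZ lc0).
have dg : (deg g <= stable_degree rho)%N.
  by rewrite /deg size_scale // -ltnS prednK // size_poly_gt0.
pose P n := `[< exists h, [/\ h \is monic, ~ stable rho h & deg h = n] >].
have exP : exists n, P n by exists (deg g); apply/asboolP; exists g.
case: (ex_minnP exP) => n /asboolP[h [mh nh dh]] nmin.
move: hm; rewrite /unstable_degree; case: xgetP => [x -> [h' [_ _ -> min']]|no _].
  by rewrite lt_def => /andP[ne le]; have := leq_trans (min' g mg ng) dg; move: ne le;
  rewrite /Order.le /= => /eqP ne; rewrite leEnat => le le'; apply: ne; congr Fin; apply/eqP;
  rewrite eqn_leq le'.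
apply: (no (Fin (deg h))); exists h; split=> // k mk nk.
by rewrite dh; apply: nmin; apply/asboolP; exists k.
Qed.

End UnstableDegree.

(** * The equivalent well-ordered family *)

Theorem lemma4p11
  (K : fieldType) (G L : ordAbGroupType)
  (v : valuation K G) (iota : {additive G -> L})
  (hv : forall g : G, exists a : K, v a = Fin g)
  (hiota : {mono iota : x y / x <= y})
  (d : Order.disp_t) (A : orderType d) (rho : A -> node v iota)
  (hC : continuous_family rho)
  (hm : (Fin (stable_degree rho) < unstable_degree rho)%O) :
  exists (d' : Order.disp_t) (B : orderType d') (zeta : B -> node v iota),
    [/\ inner_family zeta, equivalent_families rho zeta &
    [/\ well_ordered B /\ (forall j, deg_node (zeta j) = stable_degree rho),
        (forall j, ramification_index_is (zeta j) 1),
        (forall j, value_group (zeta j) = stable_group zeta)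
      & exists chi : B -> {poly K},
          (forall j, min_KP (zeta j) (chi j)) /\
          (forall j k, (j < k)%O ->
             ~ mu_equiv (zeta j) (chi j) (chi k) /\
             is_augmentation (zeta k) (zeta j) (chi k) (sv (zeta k)))]].
Proof.
have [fam degs] := hC; have [i0 hdeg] := xgetPex 0%N degs.
rewrite -/(stable_degree rho) in hdeg; set m := stable_degree rho in hm hdeg *.
have stab (f : {poly K}) : (size f <= m.+1)%N -> stable rho f by apply: stable_of_size.
(* The index set consists of finite values, as a subset of [wtop L], which is
   totally ordered. *)
pose D := [set x | exists phi, good rho m i0 phi x].
have [W [WD cofW woW]] := exists_wo_cofinal D.
pose B : orderType _ := sub_order W.
have inW (b : B) : W (val b) by apply/asboolP; apply: (valP b).
have /choice[chi gchi] (b : B) : exists phi, good rho m i0 phi (val b) by apply: WD.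
have /choice[zeta ezeta] (b : B) : exists w : node v iota,
    forall f, w f = aug (rho i0) (chi b) (val b) f.
  have gb := gchi b; have [_ _ _ lt] := gb.
  have [j s] := good_separates fam hdeg gb (lexx i0) lt.
  apply: (exists_aug_node s); apply: le_lt_trans lt.
  by apply: (sv_ge fam hdeg) => //; case: gb.
have above i : (i0 <= i)%O -> exists b : B, rho i (key rho i) < val b.
  move=> ii; have [phi [x [gphi lt]]] := good_above fam hdeg stab ii.
  have [|y Wy xy] := cofW x; first by exists phi.
  exists (exist (fun x => `[< W x >]) y (introT (asboolP _) Wy)).
  exact: lt_le_trans lt xy.
have next (b : B) : exists c : B, (b < c)%O.
  have [i ii hi] := good_bound fam hdeg (gchi b); have [c lt] := above i (ltW ii).
  by exists c; rewrite ltEsub; apply: lt_trans lt; case: (hi i (lexx i)).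
have mono (b c : B) : (b < c)%O -> node_le (zeta b) (zeta c).
  rewrite ltEsub => bc.
  exact: (aug_good_mono fam hdeg (gchi b) (ezeta b) (gchi c) (ezeta c) bc).
have [b0 _] := above i0 (lexx i0).
exists _, B, zeta; split.
- split=> // [b|b c].
    have [c] := next b; rewrite ltEsub => bc.
    exact: (aug_good_inner fam hdeg (gchi b) (ezeta b) (gchi c) (ezeta c) bc).
  split; first by rewrite le_eqVlt => /orP[/eqP -> //|]; apply: mono.
  move=> le; rewrite leNgt; apply/negP; rewrite ltEsub => cb.
  have := le (chi b); rewrite (aug_good_phi fam hdeg (gchi b) (ezeta b)).
  by rewrite (aug_good_phi' fam hdeg (gchi c) (ezeta c) (gchi b) cb) leNgt cb.
- split=> [i|b]; last exact: (aug_good_le_family fam hdeg (gchi b) (ezeta b)).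
  have ii : (i0 <= Order.max i i0)%O by rewrite le_max lexx orbT.
  have [b lt] := above _ ii; exists b => f.
  apply: le_trans (family_le_aug_good fam hdeg (gchi b) (ezeta b) ii lt f).
  by apply: (family_le fam); rewrite le_max lexx.
split.
- split=> [S S0|b]; last exact: (aug_good_deg fam hdeg (gchi b) (ezeta b)).
  have [_ [b _ <-]||_ [b Sb <-] bmin] := woW [set val b | b in S].
  - exact: inW.
  - by have [b Sb] := S0; exists (val b), b.
  by exists b => // c Sc; rewrite leEsub; apply: bmin; exists c.
- by move=> b; apply: (aug_good_ramification fam hdeg (gchi b) (ezeta b)).
- move=> b; apply/seteqP; split=> a.
    move=> /(aug_good_value_group fam hdeg (gchi b) (ezeta b))[f [f0 sf ef]].
    have ez c : zeta c f = Fin a by rewrite (aug_good_small fam hdeg (gchi c) (ezeta c) sf).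
    exists f; split=> //; first by exists b => c _; rewrite !ez.
    by split=> [|c]; [exists b|]; rewrite ez.
  move=> [f [_ _ [[c ec] _]]]; apply/(aug_good_value_group fam hdeg (gchi b) (ezeta b)).
  apply/(aug_good_value_group fam hdeg (gchi c) (ezeta c)); exact: mem_value_group ec.
exists chi; split=> [b|b c]; first exact: (aug_good_min_KP fam hdeg (gchi b) (ezeta b)).
rewrite ltEsub => bc; split.
  exact: (aug_good_not_equiv fam hdeg (gchi b) (ezeta b) (gchi c) bc).
exact: (aug_good_augmentation fam hdeg (gchi b) (ezeta b) (gchi c) (ezeta c) bc).
Qed.
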